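(* Let $K$ be a differential field of characteristic $0$ with algebraically closed field of constants $C$, and let $M$ be a Picard-Vessiot extension of $K$. Then there is a bijection between the intermediate differential fields $K\subseteq L\subseteq M$ and the algebraic subgroups of the differential Galois group of $M/K$.
   Context: A differential field is a field with one derivation $y\mapsto y'$; its constants are the elements of derivative zero. For elements $u_1,\dots,u_n$ of a differential extension of $K$, $K(u_1,\dots,u_n)$ denotes the differential subfield generated by $K$ and $u_1,\dots,u_n$. Solutions $u_1,\dots,u_n$, in a differential extension of $K$, of a homogeneous linear differential equation $y^{(n)}+a_1y^{(n-1)}+\dots+a_{n-1}y'+a_ny=0$ with coefficients $a_i\in K$ form a fundamental system of solutions if their wronskian $\det(u_i^{(j-1)})_{1\le i,j\le n}$ is nonzero. A differential extension $M\supseteq K$ is a Picard-Vessiot extension of $K$ (for such an equation) if $M=K(u_1,\dots,u_n)$ for a fundamental system of solutions $(u_1,\dots,u_n)$ of the equation and $M$ has the same field of constants as $K$. The differential Galois group of $M/K$ is the group of all differential field automorphisms of $M$ fixing $K$ elementwise; writing $\sigma u_i=\sum_j c_{ij}u_j$ with $c_{ij}\in C$, it is identified with a group of matrices $(c_{ij})$ in $GL_n(C)$. A subgroup is algebraic if the corresponding group of matrices is the set of all elements of $GL_n(C)$ at which some set of polynomials over $C$ in the $n^2$ matrix entries vanishes. An intermediate differential field is a differential field $L$ with $K\subseteq L\subseteq M$. *)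

(* Defs.v *)
From HB Require Import structures.
From mathcomp Require Import all_boot all_order all_algebra.
From mathcomp Require Import boolp classical_sets functions.
From mathcomp Require mpoly.

Set Implicit Arguments.
Unset Strict Implicit.
Unset Printing Implicit Defensive.

Import GRing.Theory.
Local Open Scope ring_scope.
Local Open Scope classical_set_scope.

HB.mixin Record Field_isDifferential F of GRing.Field F := {
  der : F -> F;
  derD : {morph der : x y / x + y};
  derM : forall x y, der (x * y) = der x * y + x * der y
}.

#[short(type="diffFieldType")]
HB.structure Definition DiffField :=
  {F of GRing.Field F & Field_isDifferential F}.

Definition constant (K : diffFieldType) : {pred K} := [pred x | der x == 0].

Fact constant_divring_closed (K : diffFieldType) : divring_closed (@constant K).
Proof.
have der0 : der (0 : K) = 0 by apply: (addIr (der 0)); rewrite -derD !add0r.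
have derN (x : K) : der (- x) = - der x.
  by apply: (addIr (der x)); rewrite -derD !addNr der0.
have der1 : der (1 : K) = 0.
  by apply: (addIr (der 1)); rewrite add0r -[in RHS](mulr1 1) derM mulr1 mul1r.
split=> [|x y /eqP dx /eqP dy|x y /eqP dx /eqP dy]; rewrite inE ?der1 //.
  by rewrite derD derN dx dy subrr.
have [->|y0] := eqVneq y 0; first by rewrite invr0 mulr0 der0.
have : der (y * y^-1) = 0 by rewrite divff.
rewrite derM dy mul0r add0r => /eqP; rewrite mulf_eq0 (negPf y0) => /eqP dyV.
by rewrite derM dx dyV mul0r mulr0 addr0.
Qed.

HB.instance Definition _ (K : diffFieldType) :=
  GRing.isDivringClosed.Build K (@constant K) (@constant_divring_closed K).

Record constField (K : diffFieldType) :=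
  ConstField { cval : K; _ : cval \in @constant K }.

HB.instance Definition _ (K : diffFieldType) := [isSub for @cval K].
HB.instance Definition _ (K : diffFieldType) := [Choice of constField K by <:].
HB.instance Definition _ (K : diffFieldType) :=
  [SubChoice_isSubIntegralDomain of constField K by <:].
HB.instance Definition _ (K : diffFieldType) :=
  [SubIntegralDomain_isSubField of constField K by <:].

Definition diff_subfield (M : diffFieldType) (L : set M) : Prop :=
  divring_closed [in L] /\ (forall x, L x -> L (der x)).

(* The equation y^(n) + a_1 y^(n-1) + ... + a_n y = 0, where [a i] is a_(i+1). *)
Definition solves_lde (K M : diffFieldType) (iota : K -> M) (n : nat)
    (a : 'I_n -> K) (y : M) : Prop :=
  iter n der y + \sum_(i < n) iota (a i) * iter (n - i.+1) der y = 0.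

Definition wronskian (M : diffFieldType) (n : nat) (u : 'I_n -> M) : M :=
  \det (\matrix_(i < n, j < n) iter j der (u i)).

Definition diff_generated (M : diffFieldType) (A : set M) : set M :=
  smallest (@diff_subfield M) A.

Definition diff_embedding (K M : diffFieldType) (iota : K -> M) : Prop :=
  {morph iota : x / der x}.

(* M, seen as an extension of K along iota, is a Picard-Vessiot extension of K
   for the equation with coefficients a and fundamental system u. *)
Definition picard_vessiot (K M : diffFieldType) (iota : K -> M) (n : nat)
    (a : 'I_n -> K) (u : 'I_n -> M) : Prop :=
  [/\ forall i, solves_lde iota a (u i),
      wronskian u != 0,
      diff_generated (range iota `|` range u) = [set: M]
    & forall y : constField M,
        exists c : constField K, iota (cval c) = cval y].

(* The differential Galois group of M/L; that of M/K is
   [diff_gal (range iota)]. *)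
Definition diff_gal (M : diffFieldType) (L : set M) : set (M -> M) :=
  [set sigma | [/\ zmod_morphism sigma, monoid_morphism sigma, bijective sigma,
     {morph sigma : x / der x} & forall x, L x -> sigma x = x]].

Definition gal_subgroup (M : diffFieldType) (L : set M) (H : set (M -> M)) : Prop :=
  [/\ H `<=` diff_gal L, H id,
      forall s t, H s -> H t -> H (s \o t)
    & forall s t, H s -> cancel s t -> cancel t s -> H t].

(* For a fundamental system u, every sigma in the Galois group has exactly one
   such matrix c, so this is the matrix group corresponding to H. *)
Definition gal_matrices (K M : diffFieldType) (iota : K -> M) (n : nat)
    (u : 'I_n -> M) (H : set (M -> M)) : set 'M[constField K]_n :=
  [set c | exists2 sigma, H sigma &
     forall i, sigma (u i) = \sum_(j < n) iota (cval (c i j)) * u j].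

(* G is closed in GL_n(C), not in the space of all matrices. The variables are
   the n^2 matrix entries, listed row by row by [mxvec]. *)
Definition zariski_closed (C : fieldType) (n : nat) (G : set 'M[C]_n) : Prop :=
  exists S : set (mpoly.mpoly (n * n) C),
    G = [set c | c \in unitmx /\
          forall p, S p -> mpoly.meval (mxvec c 0) p = 0].

Definition intermediate (K M : diffFieldType) (iota : K -> M) : set (set M) :=
  [set L | diff_subfield L /\ range iota `<=` L].

Definition algebraic_subgroup (K M : diffFieldType) (iota : K -> M) (n : nat)
    (u : 'I_n -> M) : set (set (M -> M)) :=
  [set H | gal_subgroup (range iota) H /\ zariski_closed (gal_matrices iota u H)].

(* Main.v *)
Require Import Defs.
From HB Require Import structures.
From mathcomp Require Import all_boot all_order all_algebra.
From mathcomp Require Import boolp classical_sets functions.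
From mathcomp Require Import zify ring ssrcomplements mpoly.

(* Let Y be the wronskian matrix of u, C the field of constants and L an intermediate
   field. Since Y' = Y A with A over K, the generic point X = 1 (x) Y of M (x)_L M is
   Z (Y (x) 1) for a matrix Z of constants, and M is linearly disjoint from these
   constants over C. So the L-relations of Y become polynomial conditions over C on Z;
   a matrix c in GL_n(C) satisfying them is the matrix of an automorphism over L.

   If x is not in L, then 1 (x) x - x (x) 1 is not nilpotent in M (x)_L M (characteristic
   0), so it survives in some field E receiving M (x)_L M. Specializing the entries of Z
   from E to the algebraically closed field C yields an automorphism over L moving x.
   Hence the fixed field of Gal(M/L) is L.

   Conversely, if H is an algebraic subgroup with fixed field L, a polynomial vanishing
   on H gives a relation sum_k a_k t(mu_k) = 0 valid for all t in H. The space of these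
   relations is stable under H, hence spanned by relations over L, so that they hold on
   Gal(M/L), which is therefore contained in H. *)

Set Implicit Arguments.
Unset Strict Implicit.
Unset Printing Implicit Defensive.

Import GRing.Theory.
Local Open Scope ring_scope.
Local Open Scope classical_set_scope.

(** * Maps to fields avoiding an element *)

(** M (x)_L M is never constructed. Polynomials over M in X stand for its elements, X_ij being 1 (x)
    Y_ij, and they are tested by the functionals a (x) b |-> a * f (b * m) with f in Hom_L(M, M).
    Only the subring generated by M (x) 1 and 1 (x) L[Y] is reached in this way, so the fraction x =
    P(Y) / Q(Y) has its denominator cleared at the price of unit factors.

    The field E carries no derivation, and only polynomials over C in Z can be specialized from E to
    C. The derivation is therefore used before E is chosen: the cleared difference 1 (x) x - x (x) 1
    is written as a combination of polynomials in Z with C-independent coefficients in M. One of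
    these polynomials survives in E. Keeping it and det Z nonzero under specialization gives an
    invertible matrix whose automorphism moves x. *)

Lemma Zorn_above (T : Type) (P : set (set T)) (J : set T) :
    P J ->
    (forall F : set (set T), F J -> F `<=` P -> total_on F subset ->
       P (\bigcup_(X in F) X)) ->
  exists A, [/\ J `<=` A, P A & forall B, A `<=` B -> P B -> B = A].
Proof.
move=> PJ Pchain.
have [F FP Ftot|A [PA Amax]] := @Zorn_bigcup T (fun A => P (J `|` A)).
  (* Zorn's lemma also ranges over the empty chain; adding J keeps every union above J. *)
  pose F' := [set J] `|` [set J `|` X | X in F].
  rewrite (_ : _ `|` _ = \bigcup_(X in F') X); last first.
    rewrite bigcup_setU bigcup_set1 bigcup_image; apply/seteqP.
    split=> x; first by case=> [|[X FX Xx]]; [left|right; exists X => //; right].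
    by case=> [|[X FX [|Xx]]]; [left|left|right; exists X].
  apply: Pchain; first by left.
    by move=> X [->//|[Y FY <-]]; exact: FP.
  move=> X Y [->|[X' FX <-]] [->|[Y' FY <-]].
  - by left.
  - by left; exact: subsetUl.
  - by right; exact: subsetUl.
  - by case: (Ftot _ _ FX FY) => XY; [left|right]; exact: setUS.
exists (J `|` A); split=> // B JAB PB.
have JB : J `<=` B by apply: subset_trans JAB; exact: subsetUl.
have AB : A `<=` B by apply: subset_trans JAB; exact: subsetUr.
apply/seteqP; split=> // x Bx; apply: contrapT => nx.
apply: (Amax B); last by rewrite setUidr.
by split=> // BA; apply: nx; right; exact: BA.
Qed.

Definition ideal (R : comNzRingType) (J : set R) : Prop :=
  [/\ J 0, forall x y, J x -> J y -> J (x + y) & forall a x, J x -> J (a * x)].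

(** An ideal maximal among those that contain J and miss the powers of g is prime: enlarging it by
    x, or by y, brings in a power of g, and the product of the two powers would lie in Q if x * y
    did. *)
Lemma prime_ideal_avoiding (R : comNzRingType) (J : set R) (g : R) :
    ideal J -> (forall k, ~ J (g ^+ k)) ->
  exists Q : set R, [/\ ideal Q, J `<=` Q, ~ Q g, ~ Q 1 &
    forall x y, Q (x * y) -> Q x \/ Q y].
Proof.
move=> idJ Jg.
pose P A := ideal A /\ forall k, ~ A (g ^+ k).
have [F FJ FP Ftot|Q [JQ [idQ Qg] Qmax]] := @Zorn_above R P J (conj idJ Jg).
  split; last by move=> k [X FX /(FP _ FX).2].
  split; first by exists J => //; case: idJ.
    move=> x y [X FX Xx] [Y FY Yy].
    case: (Ftot _ _ FX FY) => [XY|YX].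
      by exists Y => //; case: (FP _ FY) => -[_ + _] _; apply=> //; exact: XY.
    by exists X => //; case: (FP _ FX) => -[_ + _] _; apply=> //; exact: YX.
  by move=> a x [X FX Xx]; exists X => //; case: (FP _ FX) => -[_ _ +] _; apply.
have [Q0 QD QM] := idQ.
exists Q; split=> //; first by have := Qg 1; rewrite expr1.
  by have := Qg 0; rewrite expr0.
have ext x : ~ Q x -> exists k a, Q (g ^+ k - a * x).
  move=> nQx; pose B := [set z | exists a, Q (z - a * x)].
  apply: contrapT => nk.
  have QB : Q `<=` B by move=> z Qz; exists 0; rewrite mul0r subr0.
  have PB : P B.
    split; last by move=> k [a Qa]; apply: nk; exists k, a.
    split; first exact: QB.
      move=> y z [a Qa] [b Qb]; exists (a + b).
      by rewrite (_ : _ - _ = (y - a * x) + (z - b * x)); [exact: QD|ring].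
    move=> b y [a Qa]; exists (b * a).
    by rewrite (_ : _ - _ = b * (y - a * x)); [exact: QM|ring].
  apply: nQx; rewrite -(Qmax _ QB PB); exists 1.
  by rewrite mul1r subrr.
move=> x y Qxy; apply: contrapT => /not_orP[/ext[k [a Qk]] /ext[l [b Ql]]].
apply: (Qg (k + l)%N).
rewrite (_ : g ^+ _ = g ^+ l * (g ^+ k - a * x) +
  (a * x * (g ^+ l - b * y) + a * b * (x * y))); last by rewrite exprD; ring.
by apply: (QD); [exact: QM|apply: (QD); exact: QM].
Qed.

(* The copy of R that carries the unit ring structure needed by {fraction _},
   with inverses chosen classically. *)
Definition domain_of (R : comNzRingType)
  of (forall x y : R, x * y = 0 -> (x == 0) || (y == 0)) : Type := R.

Section domain_of.
Variables (R : comNzRingType).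
Hypothesis domR : forall x y : R, x * y = 0 -> (x == 0) || (y == 0).
Local Notation D := (domain_of domR).
HB.instance Definition _ := GRing.ComNzRing.copy D R.

Definition domain_unit : pred D := fun x => `[< exists y : D, y * x = 1 >].
Definition domain_inv (x : D) : D :=
  if pselect (exists y : D, y * x = 1) is left h then sval (cid h) else x.

Fact domain_mulVr : {in domain_unit, left_inverse 1 domain_inv *%R}.
Proof.
by move=> x /asboolP h; rewrite /domain_inv; case: pselect => // h'; case: cid.
Qed.

Fact domain_unitP (x y : D) : y * x = 1 -> domain_unit x.
Proof. by move=> h; apply/asboolP; exists y. Qed.

Fact domain_inv_out : {in [predC domain_unit], domain_inv =1 id}.
Proof.
move=> x; rewrite inE /= => /negP h; rewrite /domain_inv.
by case: pselect => // h'; case: h; apply/asboolP.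
Qed.

HB.instance Definition _ := GRing.ComNzRing_hasMulInverse.Build D
  domain_mulVr domain_unitP domain_inv_out.
HB.instance Definition _ := GRing.ComUnitRing_isIntegral.Build D domR.

Lemma domain_embeds_in_field :
  exists (E : fieldType) (f : {rmorphism R -> E}), injective f.
Proof.
exists {fraction D}, (@FracField.tofrac D : {rmorphism D -> {fraction D}}).
by move=> x y /eqP; rewrite tofrac_eq => /eqP.
Qed.

End domain_of.

Lemma field_avoiding (R : comNzRingType) (J : set R) (g : R) :
    ideal J -> (forall k, ~ J (g ^+ k)) ->
  exists (E : fieldType) (f : {rmorphism R -> E}),
    (forall x, J x -> f x = 0) /\ f g != 0.
Proof.
move=> idJ Jg; have [Q [[Q0 QD QM] JQ Qg Q1 Qprime]] := prime_ideal_avoiding idJ Jg.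
pose q : pred R := fun x => `[< Q x >].
have qI : idealr_closed q.
  split; [exact/asboolP|exact/asboolPn|].
  move=> a x y /asboolP Qx /asboolP Qy; apply/asboolP.
  by apply: QD => //; apply: QM.
have qP : prime_idealr_closed q.
  move=> x y /asboolP /Qprime [Qx|Qy]; apply/orP; [left|right]; exact/asboolP.
pose mI := isIdealr.Build R q qI.
pose mP := isPrimeIdealrClosed.Build R q qP.
pose I : prime_idealr R := HB.pack q mI mP.
have [E [f f_inj]] := domain_embeds_in_field (@Quotient.rquot_IdomainAxiom R I).
pose p : {rmorphism R -> {ideal_quot I}} := \pi_({ideal_quot I})%qT.
have p0 x : (p x == 0) = q x.
  by rewrite -(rmorph0 p) -Quotient.idealrBE subr0.
exists E, (f \o p); split=> [x /JQ Qx|] /=.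
  by have /eqP -> : p x == 0 by [rewrite p0; exact/asboolP]; rewrite rmorph0.
by rewrite -(rmorph0 f) (inj_eq f_inj) p0; apply/asboolP.
Qed.

(** * Specialization to an algebraically closed field *)

Lemma closed_root (C : fieldType) : GRing.closed_field_axiom C ->
  forall p : {poly C}, (1 < size p)%N -> exists x, root p x.
Proof.
move=> closedC p p1; have p0 : p != 0 by rewrite -size_poly_gt0 ltnW.
have lp : lead_coef p != 0 by rewrite lead_coef_eq0.
have n0 : (0 < (size p).-1)%N by rewrite -subn1 subn_gt0.
have [x xE] := closedC _ (fun k => - p`_k / lead_coef p) n0.
exists x; apply/rootP; rewrite horner_coef.
have e : (size p).-1.+1 = size p by rewrite prednK // ltnW.
rewrite -e big_ord_recr /= -lead_coefE xE mulr_sumr -big_split big1 //= => k _.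
by field.
Qed.

(** A root of p - 1 is not a root of p, which spares counting roots in an infinite field. *)
Lemma closed_nonroot (C : fieldType) : GRing.closed_field_axiom C ->
  forall p : {poly C}, p != 0 -> exists x, ~~ root p x.
Proof.
move=> closedC p p0; have [p1|p1] := ltnP 1 (size p).
  have [|x /rootP] := @closed_root C closedC (p - 1).
    by rewrite size_polyDl ?size_polyN ?size_poly1.
  rewrite hornerD hornerN hornerC => /eqP; rewrite subr_eq0 => /eqP px.
  by exists x; rewrite /root px oner_neq0.
have := p0; rewrite (size1_polyC p1) polyC_eq0 => c0.
by exists 0; rewrite /root hornerC.
Qed.

Section specialization_step.
Variables (R : comNzRingType) (E C : fieldType) (i : {rmorphism R -> E}) (s : E).
Hypothesis closedC : GRing.closed_field_axiom C.
Implicit Types p q f g : {poly R}.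

Let ev p := (map_poly i p).[s].

Let evD p q : ev (p + q) = ev p + ev q.
Proof. by rewrite /ev rmorphD hornerD. Qed.

Let evM p q : ev (p * q) = ev p * ev q.
Proof. by rewrite /ev rmorphM hornerM. Qed.

Let evZ a p : ev (a *: p) = i a * ev p.
Proof. by rewrite /ev map_polyZ hornerZ. Qed.

(** In the application i kills the algebraic relations among the earlier variables, so sizes may
    drop under [map_poly i]. The truncation has a leading coefficient that survives in E. *)
Lemma truncate p : exists2 q, map_poly i q = map_poly i p &
  size q = size (map_poly i p).
Proof.
set n := size _; have eqi : map_poly i (take_poly n p) = map_poly i p.
  apply/polyP => k; rewrite !coef_map coef_take_poly; case: ltnP => // nk.
  by rewrite raddf0 -coef_map nth_default.
exists (take_poly n p) => //; apply/eqP; rewrite eqn_leq size_take_poly /=.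
by rewrite /n -[in X in (X <= _)%N]eqi size_poly.
Qed.

Lemma faithful_lead q : size q = size (map_poly i q) -> q != 0 ->
  i (lead_coef q) != 0.
Proof.
move=> sq q0; rewrite lead_coefE sq -coef_map -lead_coefE lead_coef_eq0.
by rewrite -size_poly_gt0 -sq size_poly_gt0.
Qed.

Lemma cancel_lead f g : (0 < size g <= size f)%N ->
  (size (lead_coef g *: f - (lead_coef f *: 'X^(size f - size g)) * g)%R
   < size f)%N.
Proof.
case/andP=> g0 gf; case Ef: (size f) gf => [|m] gf.
  by move: g0; rewrite ltnNge gf.
case Eg: (size g) g0 gf => [//|n] _ gf; rewrite ltnS.
apply/leq_sizeP => k mk; rewrite -scalerAl coefB !coefZ coefXnM.
rewrite ltnNge (leq_trans _ mk) /=; last by rewrite subSS leq_subr.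
move: mk; rewrite leq_eqVlt => /orP[/eqP <-|mk].
  by rewrite subSS subKn // !lead_coefE Ef Eg mulrC subrr.
by rewrite !nth_default ?mulr0 ?subrr ?Ef ?Eg //; rewrite subSS leq_subRL ?addnS; lia.
Qed.

(** R is only a ring, so each step multiplies f by the leading coefficient of g; the accumulated
    multiplier e stays nonzero in E. *)
Lemma pseudo_division g f : g != 0 -> i (lead_coef g) != 0 ->
  exists e q r, [/\ i e != 0, e *: f = q * g + r & (size r < size g)%N].
Proof.
move=> g0 lg; have [m] := ubnP (size f); elim: m f => // m IH f.
rewrite ltnS => fm; have [fg|gf] := ltnP (size f) (size g).
  by exists 1, 0, f; rewrite rmorph1 oner_neq0 scale1r mul0r add0r.
have [|e [q [r [e0 eE rg]]]] := IH (lead_coef g *: f -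
    (lead_coef f *: 'X^(size f - size g)) * g).
  by apply: leq_trans fm; apply: cancel_lead; rewrite gf size_poly_gt0 g0.
exists (e * lead_coef g), (q + e *: (lead_coef f *: 'X^(size f - size g))), r.
split=> //; first by rewrite rmorphM mulf_neq0.
rewrite mulrDl addrAC -eE -scalerA scalerBr -(scalerAl e) -/(GRing.scale e _).
by rewrite subrK.
Qed.

Lemma evB p q : ev (p - q) = ev p - ev q.
Proof. by rewrite /ev rmorphB hornerD hornerN. Qed.

Definition relation p := ev p = 0 /\ map_poly i p != 0.

(** Here p plays the part of the minimal polynomial of s over the fraction field of the image of R,
    with denominators cleared. *)
Lemma minimal_relation : (exists p, relation p) ->
  exists p, [/\ relation p, size p = size (map_poly i p) &
    forall q, relation q -> (size p <= size (map_poly i q))%N].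
Proof.
move=> [p0 rp0].
pose P k := `[< exists2 p, relation p & size (map_poly i p) = k >].
have exP : exists k, P k by exists (size (map_poly i p0)); apply/asboolP; exists p0.
case: (ex_minnP exP) => k /asboolP[p [p1 p2] pk] kmin.
have [q qp sq] := truncate p.
exists q; split; [by split; rewrite /ev ?qp|by rewrite qp|].
by move=> f rf; rewrite sq pk; apply: kmin; apply/asboolP; exists f.
Qed.

(** Take g of least size with g(s) a nonzero multiple of B(s). If g were not constant, the remainder
    of p modulo g would vanish at s, hence be zero over E by minimality of p; the cofactor of g in p
    would then vanish at s while being shorter than p. *)
Lemma inverse_mod_relation p B :
    relation p -> size p = size (map_poly i p) ->
    (forall q, relation q -> (size p <= size (map_poly i q))%N) -> ev B != 0 ->
  exists r U, i r != 0 /\ i r = ev U * ev B.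
Proof.
move=> [p1 p2] sp pmin B0.
have p0 : p != 0 by apply: contra_neq p2 => ->; rewrite rmorph0.
pose Q k := `[< exists g U,
  [/\ ev g = ev U * ev B, ev g != 0 & size (map_poly i g) = k] >].
have exQ : exists k, Q k.
  exists (size (map_poly i B)); apply/asboolP; exists B, 1.
  by rewrite /ev rmorph1 hornerC mul1r.
case: (ex_minnP exQ) => k /asboolP[g' [U [gU g0 gk]]] kmin.
have [g gg' sg] := truncate g'.
have {}gU : ev g = ev U * ev B by rewrite /ev gg'.
have {g0} eg0 : ev g != 0 by rewrite /ev gg'.
have {}gk : size g = k by rewrite sg.
have {gg'}sg : size g = size (map_poly i g) by rewrite gg'.
have g0 : g != 0 by apply: contra_neq eg0 => ->; rewrite /ev rmorph0 horner0.
have qmin r V : ev r = ev V * ev B -> ev r != 0 -> (size g <= size r)%N.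
  move=> rV r0; rewrite gk; have : (size (map_poly i r) <= size r)%N := size_poly _ _.
  by apply: leq_trans; apply: kmin; apply/asboolP; exists r, V.
have evC c : ev c%:P = i c by rewrite /ev map_polyC hornerC.
have [g1|g1] := leqP (size g) 1.
  have e : ev g = i g`_0 by rewrite -evC -size1_polyC.
  by exists g`_0, U; rewrite -e.
have gp : (size g < size p)%N.
  have [e [q [r [e0 eE rp]]]] := pseudo_division B p0 (faithful_lead sp p0).
  have er : ev r = ev e%:P * ev B.
    by rewrite evC -evZ eE evD evM p1 mulr0 add0r.
  by apply: leq_ltn_trans rp; apply: (qmin _ e%:P er); rewrite er evC mulf_neq0.
have [e [q [r [e0 eE rg]]]] := pseudo_division p g0 (faithful_lead sg g0).
have er : ev r = - ev q * ev g.
  have := congr1 ev eE; rewrite evZ p1 mulr0 evD evM => /esym/eqP.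
  by rewrite addrC addr_eq0 mulNr => /eqP.
have r0 : ev r = 0.
  apply/eqP/negPn/negP => r0; suff: (size g <= size r)%N by rewrite leqNgt rg.
  apply: (qmin _ (- (q * U))) => //.
  have -> : ev (- (q * U)) = - (ev q * ev U).
    by rewrite -evM /ev rmorphN hornerN.
  by rewrite er gU; ring.
have q0 : ev q = 0.
  by move/eqP: er; rewrite r0 eq_sym mulf_eq0 oppr_eq0 (negPf eg0) orbF => /eqP.
have ir : map_poly i r = 0.
  apply/eqP/negPn/negP => nr; have := pmin r (conj r0 nr).
  rewrite leqNgt (leq_ltn_trans _ (ltn_trans rg gp)) //.
  exact: (size_poly _ _ : (size (map_poly i r) <= size r)%N).
have := congr1 (map_poly i) eE; rewrite map_polyZ rmorphD rmorphM /= ir addr0 => ipE.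
have ig : map_poly i g != 0 by rewrite -size_poly_gt0 -sg size_poly_gt0.
have iq : map_poly i q != 0.
  apply: contra_neq p2 => iq; move/eqP: ipE.
  by rewrite iq mul0r scaler_eq0 (negPf e0) => /eqP.
have := congr1 (size \o polyseq) ipE; rewrite /= size_scale // size_mul // -sp -sg.
move=> spE; have := pmin q (conj q0 iq); rewrite spE.
by case: (size g) g1 => [|[|m]] // _; rewrite !addnS /= ltnNge leq_addr.
Qed.

(* If s is algebraic, x is a root of the image of a relation p of minimal size, and a
   is the leading coefficient of p times a nonzero multiple r of B(s) lying in R. *)
Lemma specialize_one B : ev B != 0 ->
  exists2 a, i a != 0 & forall phi : {rmorphism R -> C},
    (forall r, i r = 0 -> phi r = 0) -> phi a != 0 ->
    exists x, (forall f, ev f = 0 -> (map_poly phi f).[x] = 0) /\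
              (map_poly phi B).[x] != 0.
Proof.
move=> B0.
have kerP (phi : {rmorphism R -> C}) f : (forall r, i r = 0 -> phi r = 0) ->
    map_poly i f = 0 -> map_poly phi f = 0.
  move=> kphi /polyP f0; apply/polyP => k; rewrite coef_map coef0; apply: kphi.
  by rewrite -coef_map f0 coef0.
have [/minimal_relation[p [[p1 p2] sp pmin]]|norel] := pselect (exists p, relation p).
  have p0 : p != 0 by apply: contra_neq p2 => ->; rewrite rmorph0.
  have [r [U [r0 rU]]] := inverse_mod_relation (conj p1 p2) sp pmin B0.
  exists (lead_coef p * r); first by rewrite rmorphM mulf_neq0 ?faithful_lead.
  move=> phi kphi; rewrite rmorphM mulf_eq0 negb_or => /andP[lp phir].
  have sizep : (1 < size p)%N.
    rewrite ltnNge; apply/negP => sp1; case/eqP: p2.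
    move: p1; rewrite (size1_polyC sp1) /ev map_polyC hornerC /= => ->.
    by rewrite polyC0.
  have [x /rootP px] : exists x, root (map_poly phi p) x.
    by apply: closed_root => //; rewrite size_poly_eq.
  (* Induction on the size: a leading coefficient of f killed by i is dropped, any other is
     cancelled against p, whose leading coefficient phi keeps nonzero. *)
  have xrel f : ev f = 0 -> (map_poly phi f).[x] = 0.
    have [m] := ubnP (size f); elim: m f => // m IH f; rewrite ltnS => fm f0.
    have [->|fn0] := eqVneq f 0; first by rewrite rmorph0 horner0.
    have [lf|lf] := eqVneq (i (lead_coef f)) 0.
      pose h := lead_coef f *: 'X^((size f).-1).
      have ih : map_poly i h = 0 by rewrite map_polyZ /= lf scale0r.
      have -> : f = (f - h) + h by rewrite subrK.
      rewrite rmorphD /= (kerP _ h) // addr0; apply: IH.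
        apply: leq_trans fm; have sf : (0 < size f)%N by rewrite size_poly_gt0.
        rewrite -(prednK sf) ltnS; apply/leq_sizeP => k.
        rewrite leq_eqVlt coefB coefZ coefXn => /orP[/eqP <-|fk].
          by rewrite eqxx mulr1 lead_coefE subrr.
        by rewrite nth_default ?gtn_eqF ?mulr0 ?subrr // -(prednK sf).
      by rewrite evB f0 /ev ih horner0 subrr.
    have pf : (size p <= size f)%N.
      have : (size (map_poly i f) <= size f)%N := size_poly _ _.
      apply: leq_trans; apply: pmin; split=> //.
      by apply: contra_neq lf => if0; rewrite lead_coefE -coef_map if0 coef0.
    have sz : (0 < size p <= size f)%N by rewrite pf ltnW.
    have /IH : (size (lead_coef p *: f -
        (lead_coef f *: 'X^(size f - size p)) * p)%R < m)%N.
      by apply: leq_trans fm; exact: cancel_lead.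
    rewrite evB evZ evM f0 p1 !mulr0 subrr => /(_ erefl).
    rewrite rmorphB rmorphM /= map_polyZ hornerD hornerN hornerM px mulr0 subr0.
    by rewrite hornerZ => /eqP; rewrite mulf_eq0 (negPf lp) => /eqP.
  exists x; split=> //; apply: contra_neq phir => Bx.
  have /xrel : ev (r%:P - U * B) = 0.
    by rewrite evB evM /ev map_polyC hornerC /= rU subrr.
  rewrite rmorphB rmorphM /= map_polyC hornerD hornerN hornerM hornerC Bx mulr0.
  by rewrite subr0.
(* Here s is transcendental over the image of R: any x that is not a root of the image of B will do,
   and the leading coefficient of [B'] keeps that image nonzero. *)
have kev f : ev f = 0 -> map_poly i f = 0.
  by move=> f0; apply: contrapT => /eqP nf; apply: norel; exists f.
have [B' iB' sB'] := truncate B.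
have B'0 : B' != 0.
  apply: contra_neq B0 => B'0; move: iB'.
  by rewrite B'0 rmorph0 /ev => <-; rewrite horner0.
exists (lead_coef B'); first by apply: faithful_lead; rewrite ?iB'.
move=> phi kphi lB.
have phiB : map_poly phi B = map_poly phi B'.
  apply/eqP; rewrite -subr_eq0 -rmorphB; apply/eqP/kerP => //.
  by rewrite rmorphB /= iB' subrr.
have [|x] := @closed_nonroot C closedC (map_poly phi B').
  by apply: contra_neq lB => b0; rewrite lead_coefE -coef_map b0 coef0.
by exists x; split; [move=> f /kev /(kerP _ _ kphi) ->; rewrite horner0|rewrite phiB].
Qed.

End specialization_step.

(** Generated by ring operations rather than by a condition on coefficients, so that evaluation
    facts go by induction; for S = setT this is an induction principle for all polynomials. *)
Inductive mpoly_over (N : nat) (R : comNzRingType) (S : set R) :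
    {mpoly R[N]} -> Prop :=
| mpoly_overC c of S c : mpoly_over S c%:MP
| mpoly_overX k : mpoly_over S 'X_k
| mpoly_overD p q of mpoly_over S p & mpoly_over S q : mpoly_over S (p + q)
| mpoly_overM p q of mpoly_over S p & mpoly_over S q : mpoly_over S (p * q).

Lemma mpoly_overT (N : nat) (R : comNzRingType) (p : {mpoly R[N]}) :
  mpoly_over setT p.
Proof.
elim/mpolyind: p => [|c m p _ _ IH].
  by rewrite -mpolyC0; exact: mpoly_overC.
apply: mpoly_overD => //; rewrite -mul_mpolyC; apply: mpoly_overM.
  exact: mpoly_overC.
rewrite mpolyXE_id; elim/big_ind: _ => [|q r|k _].
- by rewrite -[1]mpolyC1; exact: mpoly_overC.
- exact: mpoly_overM.
elim: (m _) => [|d IHd].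
  by rewrite expr0 -[1]mpolyC1; exact: mpoly_overC.
by rewrite exprS; apply: mpoly_overM => //; exact: mpoly_overX.
Qed.

Lemma mpoly_rmorph_eq (N : nat) (R S : comNzRingType)
    (f g : {rmorphism {mpoly R[N]} -> S}) :
  (forall c, f c%:MP = g c%:MP) -> (forall k, f 'X_k = g 'X_k) -> f =1 g.
Proof.
move=> fgC fgX p; elim: (mpoly_overT p) => // q r _ e _ e'.
  by rewrite !rmorphD e e'.
by rewrite !rmorphM e e'.
Qed.

(** A form of the Nullstellensatz, by induction on the number of variables. The last variable is
    specialized by [specialize_one] over the ring of polynomials in the others; the element a to be
    kept nonzero there becomes the b of the induction hypothesis. *)
Lemma specialization (C E : fieldType) (kappa : {rmorphism C -> E}) (N : nat)
    (t : 'I_N -> E) (b : {mpoly C[N]}) :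
    GRing.closed_field_axiom C -> mmap kappa t b != 0 ->
  exists x : 'I_N -> C,
    (forall f, mmap kappa t f = 0 -> f.@[x] = 0) /\ b.@[x] != 0.
Proof.
move=> closedC; elim: N t b => [|N IH] t b b0.
  have cst (f : {mpoly C[0]}) : exists c, f = c%:MP.
    elim: (mpoly_overT f) => [c _|[]//|p q _ [c ->] _ [d ->]|p q _ [c ->] _ [d ->]].
    - by exists c.
    - by exists (c + d); rewrite mpolyCD.
    - by exists (c * d); rewrite mpolyCM.
  exists (fun=> 0); split=> [f|]; last first.
    have [c e] := cst b; rewrite e mmapC in b0; rewrite e mevalC.
    by apply: contra_neq b0 => ->; rewrite raddf0.
  by have [c ->] := cst f; rewrite mmapC mevalC => /eqP; rewrite fmorph_eq0 => /eqP.
pose R : comNzRingType := {mpoly C[N]}.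
pose t' k := t (widen_ord (leqnSn N) k).
pose v (k : 'I_N.+1) : {poly R} := if unlift ord_max k is Some k' then ('X_k')%:P else 'X.
pose uni : {rmorphism {mpoly C[N.+1]} -> {poly R}} := mmap (polyC \o @mpolyC N C) v.
pose i : {rmorphism R -> E} := mmap kappa t'.
have uniE f : (map_poly i (uni f)).[t ord_max] = mmap kappa t f.
  pose F : {rmorphism {mpoly C[N.+1]} -> E} :=
    (horner_eval (t ord_max) \o map_poly i) \o uni.
  pose G : {rmorphism {mpoly C[N.+1]} -> E} := mmap kappa t.
  apply: (@mpoly_rmorph_eq _ _ _ F G) => [c|k] /=.
    by rewrite /horner_eval /uni /= !mmapC /= map_polyC hornerC /i /= mmapC.
  rewrite /horner_eval /uni /= !mmapX !mmap1U /v; case: unliftP => [k' ->|->].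
    rewrite map_polyC hornerC /i /= mmapX mmap1U /t'; congr t.
    by apply: val_inj; rewrite /= /bump leqNgt ltn_ord.
  by rewrite map_polyX hornerX.
rewrite -uniE in b0.
have [a a0 step] := specialize_one closedC b0.
have [x [xrel xa]] := IH t' a a0.
have [y [yrel yb]] := step (meval x : {rmorphism R -> C}) xrel xa.
pose z k := if unlift ord_max k is Some k' then x k' else y.
have zE f : f.@[z] = (map_poly (meval x) (uni f)).[y].
  pose F : {rmorphism {mpoly C[N.+1]} -> C} :=
    (horner_eval y \o map_poly (meval x : {rmorphism R -> C})) \o uni.
  pose G : {rmorphism {mpoly C[N.+1]} -> C} := meval z.
  apply/esym; apply: (@mpoly_rmorph_eq _ _ _ F G) => [c|k] /=.
    by rewrite /horner_eval /uni /= !mmapC /= map_polyC hornerC /= !mevalC.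
  rewrite /horner_eval /uni /= mmapX !mmap1U mevalXU /v /z; case: unlift => [k'|].
    by rewrite map_polyC hornerC /= mevalXU.
  by rewrite map_polyX hornerX.
by exists z; split=> [f|]; rewrite zE // -uniE => /yrel.
Qed.

(** * Linear functionals and nilpotency of 1 (x) x - x (x) 1 *)

Definition subfield (M : fieldType) (L : set M) : Prop :=
  [/\ L 1, forall x y, L x -> L y -> L (x - y) &
      forall x y, L x -> L y -> L (x / y)].

Section linear_functionals.
Variables (M : fieldType) (L : set M).
Hypothesis Lsub : subfield L.

Let L1 : L 1. Proof. by case: Lsub. Qed.

Let LB x y : L x -> L y -> L (x - y). Proof. by case: Lsub => _ + _; apply. Qed.

Let Ldiv x y : L x -> L y -> L (x / y). Proof. by case: Lsub => _ _; apply. Qed.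

Lemma subfield0 : L 0.
Proof. by rewrite -(subrr 1); exact: LB. Qed.

Lemma subfieldN x : L x -> L (- x).
Proof. by move=> Lx; rewrite -sub0r; apply: LB => //; exact: subfield0. Qed.

Lemma subfieldD x y : L x -> L y -> L (x + y).
Proof. by move=> Lx Ly; rewrite -(opprK y); apply/LB/subfieldN. Qed.

Lemma subfieldV x : L x -> L x^-1.
Proof. by move=> Lx; rewrite -div1r; exact: Ldiv. Qed.

Lemma subfieldM x y : L x -> L y -> L (x * y).
Proof. by move=> Lx Ly; rewrite -(invrK y); apply/Ldiv/subfieldV. Qed.

Lemma subfieldMn x n : L x -> L (x *+ n).
Proof.
move=> Lx; elim: n => [|n IH]; first by rewrite mulr0n; exact: subfield0.
by rewrite mulrS; exact: subfieldD.
Qed.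

Definition linear_over (f : M -> M) : Prop :=
  (forall x y, f (x + y) = f x + f y) /\ (forall l x, L l -> f (l * x) = l * f x).

Definition subspace_over (V : set M) : Prop :=
  [/\ V 0, forall x y, V x -> V y -> V (x + y) & forall l x, L l -> V x -> V (l * x)].

(** A subspace W maximal among those that contain V and miss x is a complement of the line L x; f is
    the coordinate along x modulo W. *)
Lemma separating_functional (V : set M) (x : M) :
    subspace_over V -> ~ V x ->
  exists2 f, linear_over f & (forall v, V v -> f v = 0) /\ f x = 1.
Proof.
move=> sV nVx; pose P W := subspace_over W /\ ~ W x.
have [F FV FP Ftot|W [VW [[W0 WD WZ] nWx] Wmax]] := @Zorn_above M P V (conj sV nVx).
  split; last by move=> [X FX]; have [] := FP _ FX.
  split.
  - by exists V => //; case: sV.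
  - move=> y z [X FX Xy] [Y FY Yz]; case: (Ftot _ _ FX FY) => [XY|YX].
      by exists Y => //; case: (FP _ FY) => -[_ + _] _; apply=> //; exact: XY.
    by exists X => //; case: (FP _ FX) => -[_ + _] _; apply=> //; exact: YX.
  - by move=> l y Ll [X FX Xy]; exists X => //; case: (FP _ FX) => -[_ _ +] _; apply.
have WN y : W y -> W (- y).
  by move=> Wy; rewrite -mulN1r; apply: WZ => //; exact: subfieldN.
have dec y : exists l, L l /\ W (y - l * x).
  have [Wy|nWy] := pselect (W y).
    by exists 0; rewrite mul0r subr0; split=> //; exact: subfield0.
  pose U := [set z | exists2 l, L l & W (z - l * y)].
  have WU : W `<=` U.
    by move=> z Wz; exists 0; rewrite ?mul0r ?subr0 //; exact: subfield0.
  have [l Ll Wxl] : U x.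
    apply: contrapT => nUx; apply: nWy; rewrite -(Wmax U) //.
      by exists 1 => //; rewrite mul1r subrr.
    split=> //; split; first exact: WU.
      move=> a b [k Lk Wa] [l Ll Wb]; exists (k + l); first exact: subfieldD.
      by rewrite (_ : _ - _ = (a - k * y) + (b - l * y)); [exact: WD|ring].
    move=> k a Lk [l Ll Wa]; exists (k * l); first exact: subfieldM.
    by rewrite (_ : _ - _ = k * (a - l * y)); [exact: WZ|ring].
  have l0 : l != 0 by apply/eqP => l0; apply: nWx; move: Wxl; rewrite l0 mul0r subr0.
  exists l^-1; split; first exact: subfieldV.
  rewrite (_ : _ - _ = - (l^-1 * (x - l * y))); last by field.
  by apply: WN; apply: WZ => //; exact: subfieldV.
have uniq y l k : L l -> L k -> W (y - l * x) -> W (y - k * x) -> l = k.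
  move=> Ll Lk Wl Wk; apply/eqP; rewrite -subr_eq0; apply/negPn/negP => lk0.
  apply: nWx; rewrite (_ : x = (l - k)^-1 * ((y - k * x) - (y - l * x))).
    apply: WZ; first exact/subfieldV/LB.
    by apply: WD => //; exact: WN.
  by field.
pose f y := sval (cid (dec y)).
have fE y l : L l -> W (y - l * x) -> f y = l.
  by move=> Ll Wl; rewrite /f; case: cid => k [Lk Wk] /=; exact: uniq Wk Wl.
have fP y : L (f y) /\ W (y - f y * x) by rewrite /f; case: cid.
exists f; split.
- move=> y z; have [[Ly Wy] [Lz Wz]] := (fP y, fP z).
  apply: fE; first exact: subfieldD.
  by rewrite (_ : _ - _ = (y - f y * x) + (z - f z * x)); [exact: WD|ring].
- move=> l y Ll; have [Ly Wy] := fP y; apply: fE; first exact: subfieldM.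
  by rewrite (_ : _ - _ = l * (y - f y * x)); [exact: WZ|ring].
- move=> v Vv; apply: fE; first exact: subfield0.
  by rewrite mul0r subr0; exact: VW.
- by apply: fE => //; rewrite mul1r subrr.
Qed.

(** The image of p under X |-> 1 (x) x, tested by the functional a (x) b |-> a * f (b * m). *)
Definition poly_form (x : M) (f : M -> M) (m : M) (p : {poly M}) : M :=
  \sum_(k < size p) p`_k * f (x ^+ k * m).

Section poly_form.
Variable x : M.
Implicit Types (f : M -> M) (p q : {poly M}).

Let form_widen f m (p : {poly M}) n : (size p <= n)%N ->
  poly_form x f m p = \sum_(k < n) p`_k * f (x ^+ k * m).
Proof.
move=> pn; rewrite /poly_form (big_ord_widen n (fun k => p`_k * f (x ^+ k * m))) //.
rewrite big_mkcond /=; apply: eq_bigr => k _; case: ltnP => // pk.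
by rewrite nth_default ?mul0r.
Qed.

Lemma poly_formD f m p q :
  poly_form x f m (p + q) = poly_form x f m p + poly_form x f m q.
Proof.
rewrite !(@form_widen _ _ _ (maxn (size p) (size q))) ?leq_maxl ?leq_maxr //.
  by rewrite -big_split; apply: eq_bigr => k _; rewrite coefD mulrDl.
exact: size_polyD.
Qed.

Lemma poly_formZ f m c p : poly_form x f m (c *: p) = c * poly_form x f m p.
Proof.
rewrite (@form_widen _ _ _ (size p)) ?size_scale_leq // mulr_sumr.
by apply: eq_bigr => k _; rewrite coefZ mulrA.
Qed.

Lemma poly_formMX f m p : poly_form x f m (p * 'X) = poly_form x f (x * m) p.
Proof.
rewrite (@form_widen _ _ _ (size p).+1); last first.
  by have [->|/size_mulX ->] := eqVneq p 0; rewrite ?mul0r ?size_poly0.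
rewrite big_ord_recl coefMX mul0r add0r; apply: eq_bigr => k _.
by rewrite coefMX /= exprSr mulrA.
Qed.

Lemma poly_formC f m c : poly_form x f m c%:P = c * f m.
Proof.
rewrite (@form_widen _ _ _ 1) ?size_polyC_leq1 // big_ord1.
by rewrite coefC expr0 mul1r.
Qed.

Lemma poly_form_eval f m p : linear_over f -> (forall k, L p`_k) ->
  poly_form x f m p = f (p.[x] * m).
Proof.
move=> [fD fZ] Lp; have f0 : f 0 = 0 by apply: (addIr (f 0)); rewrite -fD !add0r.
rewrite horner_coef mulr_suml (big_morph f fD f0); apply: eq_bigr => k _.
by rewrite -mulrA [RHS]fZ.
Qed.

Definition twist (f : M -> M) (m : M) : M := f (x * m) - x * f m.

(** Multiplication by X - x is multiplication by 1 (x) x - x (x) 1, and [twist] is its adjoint on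
    functionals. *)
Lemma poly_form_twist f m n p :
  poly_form x (iter n twist f) m p = poly_form x f m (('X - x%:P) ^+ n * p).
Proof.
elim: n p => [|n IH] p; first by rewrite expr0 mul1r.
have -> : ('X - x%:P) ^+ n.+1 * p =
    ('X - x%:P) ^+ n * (p * 'X) + (- x) *: (('X - x%:P) ^+ n * p).
  by rewrite -mul_polyC polyCN exprS; ring.
rewrite poly_formD poly_formZ -!IH poly_formMX /= /poly_form mulr_sumr -big_split.
by apply: eq_bigr => k _ /=; rewrite {1}/twist [x ^+ k * (x * m)]mulrCA; ring.
Qed.

End poly_form.

(* If R_x - L_x is nilpotent on Hom_L(M, M), where R_x f = f (x * _) and L_x f =
   x * f, then x is algebraic over L; its minimal polynomial kills R_x and has x
   as a simple root, hence R_x = L_x. *)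
Lemma twist_nilpotent x n : [pchar M] =i pred0 ->
  (forall f m, linear_over f -> iter n (twist x) f m = 0) -> L x.
Proof.
move=> char0 nil; apply: contrapT => nLx.
pose N (p : {poly M}) := forall f m, linear_over f -> poly_form x f m p = 0.
have ND p q : N p -> N q -> N (p + q).
  by move=> Np Nq f m lf; rewrite poly_formD Np ?Nq ?addr0.
have NZ c p : N p -> N (c *: p) by move=> Np f m lf; rewrite poly_formZ Np ?mulr0.
have NM q p : N p -> N (q * p).
  move=> Np; elim/poly_ind: q => [|q c IH].
    by rewrite mul0r -(scale0r p); exact: NZ.
  rewrite mulrDl mul_polyC mulrAC; apply: ND; last exact: NZ.
  by move=> f m lf; rewrite poly_formMX IH.
have N1 : N (('X - x%:P) ^+ n).
  move=> f m lf; rewrite -[_ ^+ n]mulr1 -poly_form_twist.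
  by rewrite -[1]/(1%:P) poly_formC mul1r nil.
pose over (p : {poly M}) := forall k, L p`_k.
pose V := [set p.[x] | p in [set p | over p /\ (size p <= n)%N]].
(* A functional that vanishes on 1, ..., x^(n-1) and is 1 at x^n would send (X - x)^n to its leading
   coefficient 1, against [N1]. *)
have Vxn : V (x ^+ n).
  apply: contrapT => nV; have [|f lf [fV fx]] := separating_functional _ nV.
    split.
    - exists 0; rewrite ?horner0 //; split; last by rewrite size_poly0.
      by move=> k; rewrite coef0; exact: subfield0.
    - move=> _ _ [p [Lp pn] <-] [q [Lq qn] <-]; exists (p + q).
        split; first by move=> k; rewrite coefD; exact: subfieldD.
        by rewrite (leq_trans (size_polyD _ _)) // geq_max pn.
      by rewrite hornerD.
    - move=> l _ Ll [p [Lp pn] <-]; exists (l *: p); last by rewrite hornerZ.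
      split; first by move=> k; rewrite coefZ; exact: subfieldM.
      by rewrite (leq_trans (size_scale_leq _ _)).
  have := N1 f 1 lf; rewrite /poly_form size_exp_XsubC big_ord_recr /= big1.
    have := monic_exp n (monicXsubC x); rewrite monicE lead_coefE size_exp_XsubC /=.
    by move=> /eqP ->; rewrite add0r mul1r mulr1 fx => /eqP; rewrite oner_eq0.
  move=> k _; rewrite mulr1 fV ?mulr0 //; exists 'X^k; last by rewrite hornerXn.
  split; last by rewrite size_polyXn.
  move=> j; rewrite coefXn; case: eqP => // _; exact: subfield0.
pose rel k := `[< exists p, [/\ over p, p != 0, p.[x] = 0 & size p = k] >].
have exrel : exists k, rel k.
  have [p [Lp pn] px] := Vxn; exists (size ('X^n - p)); apply/asboolP.
  exists ('X^n - p); split=> //.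
  - move=> k; rewrite coefB coefXn; apply: LB => //.
    by case: eqP => // _; exact: subfield0.
  - rewrite -size_poly_gt0 size_polyDl ?size_polyN ?size_polyXn //.
  - by rewrite hornerD hornerN hornerXn px subrr.
case: (ex_minnP exrel) => k /asboolP[p [Lp p0 px pk]] kmin.
have p1 : (1 < size p)%N.
  rewrite ltnNge; apply/negP => p1; move: p0 px; rewrite (size1_polyC p1).
  by rewrite polyC_eq0 hornerC => /eqP.
have dp0 : p^`() != 0.
  apply/eqP => /polyP /(_ (size p).-2); rewrite coef_deriv coef0 => /eqP.
  have -> : (size p).-2.+1 = (size p).-1 by case: (size p) p1 => [|[]].
  rewrite -lead_coefE -mulr_natr mulf_eq0 lead_coef_eq0 (negPf p0) /=.
  by rewrite (pcharf0P M).1 //; case: (size p) p1 => [|[]].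
have dpx : p^`().[x] != 0.
  apply/eqP => dpx; have : (k <= size p^`())%N.
    apply: kmin; apply/asboolP; exists p^`(); split=> // j.
    by rewrite coef_deriv; exact: subfieldMn.
  by rewrite -pk leqNgt lt_size_deriv.
have /factor_theorem[q pq] : root p x by apply/rootP.
have qx : q.[x] != 0.
  move: dpx; rewrite pq derivM derivXsubC mulr1 hornerD hornerM hornerXsubC subrr.
  by rewrite mulr0 add0r.
have cop : coprimep (('X - x%:P) ^+ n) q.
  by apply: coprimep_expl; rewrite coprimep_sym coprimep_XsubC.
have /Bezout_eq1_coprimepP[[u v] /= uv] := cop.
have Np : N p by move=> f m lf; rewrite poly_form_eval // px mul0r; case: lf => fD _;
  apply: (addIr (f 0)); rewrite -fD !add0r.
(* The Bezout identity for (X - x)^n and the cofactor q, multiplied by X - x. *)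
have NX : N ('X - x%:P).
  have -> : 'X - x%:P = (u * ('X - x%:P)) * ('X - x%:P) ^+ n + v * p.
    by rewrite pq -[LHS]mulr1 -uv; ring.
  by apply: ND; exact: NM.
have [||f lf [f1 fx]] := @separating_functional L x => //.
  by split; [exact: subfield0|exact: subfieldD|exact: subfieldM].
have := NX f 1 lf; rewrite -['X - _]expr1 -[_ ^+ 1]mulr1 -poly_form_twist.
rewrite -polyC1 poly_formC mul1r /= /twist mulr1 fx f1 // mulr0 subr0.
by move/eqP; rewrite oner_eq0.
Qed.

End linear_functionals.

(** * The tensor product M (x)_L M, seen through functionals *)

Section mpoly_form.
Variables (M : fieldType) (N : nat) (y : 'I_N -> M).
Implicit Types (f : M -> M) (m : M) (p q : {mpoly M[N]}).

Definition mpoly_form f m p : M :=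
  \sum_(k <- msupp p) p@_k * f ('X_[k].@[y] * m).

Let form_widen f m p d : (msize p <= d)%N ->
  mpoly_form f m p = \sum_(k : 'X_{1..N < d}) p@_k * f ('X_[k].@[y] * m).
Proof.
move=> pd; pose I : subFinType _ := 'X_{1..N < d}.
rewrite /mpoly_form (big_mksub I) ?msupp_uniq //=; first last.
  by move=> k /msize_mdeg_lt /leq_trans; apply.
by rewrite big_rmcond //= => k /memN_msupp_eq0 ->; rewrite mul0r.
Qed.

Lemma mpoly_formD f m p q :
  mpoly_form f m (p + q) = mpoly_form f m p + mpoly_form f m q.
Proof.
rewrite !(@form_widen _ _ _ (maxn (msize p) (msize q))) ?leq_maxl ?leq_maxr //.
  by rewrite -big_split; apply: eq_bigr => k _; rewrite mcoeffD mulrDl.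
exact: msizeD_le.
Qed.

Lemma mpoly_formZ f m c p : mpoly_form f m (c *: p) = c * mpoly_form f m p.
Proof.
rewrite !(@form_widen _ _ _ (msize p)) ?msizeZ_le // mulr_sumr.
by apply: eq_bigr => k _; rewrite mcoeffZ mulrA.
Qed.

Lemma mpoly_form0 f m : mpoly_form f m 0 = 0.
Proof. by rewrite -(scale0r 0) mpoly_formZ mul0r. Qed.

Lemma mpoly_form_sum f m (I : Type) (r : seq I) (F : I -> {mpoly M[N]}) :
  mpoly_form f m (\sum_(k <- r) F k) = \sum_(k <- r) mpoly_form f m (F k).
Proof. exact: (big_morph _ (mpoly_formD f m) (mpoly_form0 f m)). Qed.

Lemma mpoly_formX f m k : mpoly_form f m 'X_[k] = f ('X_[k].@[y] * m).
Proof. by rewrite /mpoly_form msuppX big_seq1 mcoeffX eqxx mul1r. Qed.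

Lemma mpoly_formC f m c : mpoly_form f m c%:MP = c * f m.
Proof.
by rewrite -[c%:MP]mulr1 mul_mpolyC mpoly_formZ -mpolyX0 mpoly_formX mpolyX0 meval1 mul1r.
Qed.

Lemma mpoly_formXM f m i p : mpoly_form f m ('X_i * p) = mpoly_form f (y i * m) p.
Proof.
rewrite {1}(mpolyE p) mulr_sumr mpoly_form_sum; apply: eq_bigr => k _.
rewrite -scalerAr mpoly_formZ -mpolyXD mpoly_formX mpolyXD mevalM mevalXU.
by congr (_ * f _); ring.
Qed.

Lemma mpoly_formCM f m c p : mpoly_form f m (c%:MP * p) = c * mpoly_form f m p.
Proof. by rewrite mul_mpolyC mpoly_formZ. Qed.

Variable L : set M.
Hypothesis Lsub : subfield L.

Lemma mpoly_form_addr f m m' p : linear_over L f ->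
  mpoly_form f (m + m') p = mpoly_form f m p + mpoly_form f m' p.
Proof.
move=> [fD _]; rewrite -big_split; apply: eq_bigr => k _ /=.
by rewrite -mulrDr -fD -mulrDr.
Qed.

Lemma mpoly_form_scaler f l m p : linear_over L f -> L l ->
  mpoly_form f (l * m) p = l * mpoly_form f m p.
Proof.
move=> [_ fZ] Ll; rewrite mulr_sumr; apply: eq_bigr => k _ /=.
by rewrite mulrCA fZ // mulrCA.
Qed.

(** Coefficients in L cross the tensor sign, so p acts as 1 (x) p(y) and is absorbed into m. *)
Lemma mpoly_form_overM f m p q : linear_over L f -> mpoly_over L p ->
  mpoly_form f m (p * q) = mpoly_form f (p.@[y] * m) q.
Proof.
move=> lf Lp; elim: Lp m q => [c Lc|i|p1 p2 _ IH1 _ IH2|p1 p2 _ IH1 _ IH2] m q.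
- by rewrite mpoly_formCM mevalC mpoly_form_scaler.
- by rewrite mpoly_formXM mevalXU.
- by rewrite mulrDl mpoly_formD IH1 IH2 mevalD mulrDl mpoly_form_addr.
- by rewrite -mulrA IH1 IH2 mevalM mulrA [p2.@[y] * _]mulrC.
Qed.

(* The kernel of M[X] -> M (x)_L M, X |-> 1 (x) y: elements of the tensor product
   are tested against the functionals a (x) b |-> a * f b with f in Hom_L(M, M). *)
Definition tensor_null : set {mpoly M[N]} :=
  [set p | forall f m, linear_over L f -> mpoly_form f m p = 0].

(** Multiplying by a variable replaces m by [y i * m], so the quantification over m gives closure
    under products. *)
Lemma tensor_null_ideal : ideal tensor_null.
Proof.
split=> [f m _|p q Np Nq f m lf|q p]; first exact: mpoly_form0.
  by rewrite mpoly_formD Np ?Nq ?addr0.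
elim: (mpoly_overT q) p => [c _|i|p1 p2 _ IH1 _ IH2|p1 p2 _ IH1 _ IH2] p Np.
- by move=> f m lf; rewrite mpoly_formCM Np ?mulr0.
- by move=> f m lf; rewrite mpoly_formXM Np.
- by move=> f m lf; rewrite mulrDl mpoly_formD IH1 ?IH2 ?addr0.
- by rewrite -mulrA; apply/IH1/IH2.
Qed.

End mpoly_form.

(** * Linear differential systems *)

Section derivation.
Variable M : diffFieldType.
Implicit Types x y : M.

Lemma der0 : der (0 : M) = 0.
Proof. by apply: (addIr (der 0)); rewrite -derD !add0r. Qed.

Lemma derN x : der (- x) = - der x.
Proof. by apply: (addIr (der x)); rewrite -derD !addNr der0. Qed.

Lemma der1 : der (1 : M) = 0.
Proof. by apply: (addIr (der 1)); rewrite add0r -[in RHS](mulr1 1) derM mulr1 mul1r. Qed.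

Lemma der_sum (I : Type) (r : seq I) (F : I -> M) :
  der (\sum_(k <- r) F k) = \sum_(k <- r) der (F k).
Proof. exact: (big_morph der (@derD M) der0). Qed.

Lemma derV x : x != 0 -> der x^-1 = - der x / x ^+ 2.
Proof.
move=> x0; have : der (x * x^-1) = 0 by rewrite divff // der1.
rewrite derM => /eqP; rewrite addrC addr_eq0 => /eqP e.
by apply: (mulfI x0); rewrite e; field.
Qed.

Lemma der_mulmx (k l m : nat) (a : 'M[M]_(k, l)) (b : 'M[M]_(l, m)) :
  map_mx der (a *m b) = map_mx der a *m b + a *m map_mx der b.
Proof.
apply/matrixP => i j; rewrite !mxE der_sum -big_split; apply: eq_bigr => s _.
by rewrite !mxE derM.
Qed.

End derivation.

Definition independent (C M : fieldType) (kappa : C -> M) (r : nat) (m : 'I_r -> M) :=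
  forall c : 'I_r -> C, \sum_k kappa (c k) * m k = 0 -> forall k, c k = 0.

Section linear_system.
Variables (M : diffFieldType) (C : fieldType) (kappa : {rmorphism C -> M}).
Variables (n : nat) (Y A : 'M[M]_n).
Hypothesis der_kappa : forall c, der (kappa c) = 0.
Hypothesis kappa_surj : forall x : M, der x = 0 -> exists c, x = kappa c.
Hypothesis Yunit : Y \in unitmx.
Hypothesis derY : map_mx der Y = Y *m A.

Local Notation W := (invmx Y).
Local Notation N := (n * n)%N.
Local Notation y := (mxvec Y 0).
Local Notation idx := mxvec_index.

Lemma der_invmx : map_mx der W = - (A *m W).
Proof.
have : map_mx der (Y *m W) = 0.
  rewrite mulmxV //; apply/matrixP => i j; rewrite !mxE.
  by case: (i == j); rewrite ?der0 ?der1.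
rewrite der_mulmx derY -mulmxA -mulmxDr => /(congr1 (mulmx W)).
rewrite mulKmx // mulmx0 => /eqP; rewrite addrC addr_eq0 => /eqP //.
Qed.

(** This is the matrix Z of constants, written in M[X]. *)
Definition generic_matrix : 'M[{mpoly M[N]}]_n :=
  \matrix_(i, j) 'X_(idx i j) *m map_mx (@mpolyC N M) W.

Definition psi : {mpoly C[N]} -> {mpoly M[N]} :=
  mmap (@mpolyC N M \o kappa) (mxvec generic_matrix 0).

HB.instance Definition _ := GRing.RMorphism.on psi.

Lemma psiC c : psi c%:MP = (kappa c)%:MP.
Proof. by rewrite /psi mmapC. Qed.

Lemma psiX i j : psi 'X_(idx i j) = \sum_l (W l j)%:MP * 'X_(idx i l).
Proof.
rewrite /psi mmapX mmap1U mxvecE !mxE; apply: eq_bigr => l _.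
by rewrite !mxE mulrC.
Qed.

Lemma meval_psi (c : 'M[C]_n) p :
  (psi p).@[mxvec (map_mx kappa c *m Y) 0] = kappa p.@[mxvec c 0].
Proof.
pose V := mxvec (map_mx kappa c *m Y) 0.
pose F : {rmorphism {mpoly C[N]} -> M} := meval V \o psi.
pose G : {rmorphism {mpoly C[N]} -> M} := kappa \o meval (mxvec c 0).
apply: (@mpoly_rmorph_eq _ _ _ F G) => [d|k] /=.
  by rewrite psiC !mevalC.
case/mxvec_indexP: k => i j; rewrite psiX mevalXU mxvecE rmorph_sum /=.
transitivity ((map_mx kappa c *m Y *m W) i j); last by rewrite mulmxK // mxE.
rewrite [RHS]mxE; apply: eq_bigr => l _.
by rewrite rmorphM /= mevalC mevalXU /V mxvecE mulrC.
Qed.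

Section over_subfield.
Variable L : set M.
Hypothesis Lsub : subfield L.
Hypothesis Lder : forall x, L x -> L (der x).
Hypothesis LA : forall i j, L (A i j).

Local Notation J := (tensor_null y L).
Local Notation form := (mpoly_form y).

(** Differentiating a * f b gives a' * f b + a * f b', which is the derivation of M (x)_L M, plus a
    times the commutator at b. *)
Definition commutator (f : M -> M) (x : M) : M := der (f x) - f (der x).

Lemma commutator_linear f : linear_over L f -> linear_over L (commutator f).
Proof.
move=> [fD fZ]; split=> [a b|l a Ll].
  by rewrite /commutator fD !derD fD; ring.
by rewrite /commutator fZ // !derM fD !fZ //; [ring|exact: Lder].
Qed.

(* The entries of the generic matrix X Y^-1 are constants of M (x)_L M. *)
Lemma der_form_psi f m p : linear_over L f ->
  der (form f m (psi p)) = form (commutator f) m (psi p) + form f (der m) (psi p).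
Proof.
pose derives (F : {mpoly M[N]}) := forall f m, linear_over L f ->
  der (form f m F) = form (commutator f) m F + form f (der m) F.
(* The extra factor F lets the induction on p pass through products. *)
suff H F : derives F -> derives (psi p * F).
  have : derives 1.
    move=> g k _; rewrite -mpolyC1 !mpoly_formC !mul1r /commutator.
    by rewrite subrK.
  by move=> /H; rewrite mulr1; exact.
elim: (mpoly_overT p) F => [c _|k|p1 p2 _ IH1 _ IH2|p1 p2 _ IH1 _ IH2] F dF.
- move=> g k lg; rewrite psiC !mpoly_formCM derM der_kappa mul0r add0r.
  by rewrite dF // mulrDr.
- case/mxvec_indexP: k => i j g k lg; rewrite psiX mulr_suml !mpoly_form_sum der_sum.
  have dg := commutator_linear lg.
  pose B l := form g (Y i l * k) F.
  have YE l : y (idx i l) = Y i l by rewrite mxvecE.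
  (* [D l] collects the contributions of the derivatives of W and Y; they cancel in the sum because
     W' = - A W and Y' = Y A. *)
  pose D l := - (\sum_s A l s * W s j) * B l + W l j * \sum_s A s l * B s.
  have D0 : \sum_l D l = 0.
    rewrite big_split /= (eq_bigr (fun l => - \sum_s A l s * W s j * B l)); last first.
      by move=> l _; rewrite mulNr mulr_suml.
    rewrite sumrN [X in _ + X](eq_bigr (fun l => \sum_s A s l * W l j * B s)).
      by rewrite exchange_big /= addNr.
    by move=> l _; rewrite mulr_sumr; apply: eq_bigr => s _; ring.
  rewrite -[RHS]addr0 -[X in _ = _ + X]D0 -!big_split; apply: eq_bigr => l _ /=.
  rewrite -!mulrA !mpoly_formCM !mpoly_formXM derM dF // YE derM.
  have -> : der (W l j) = - \sum_s A l s * W s j.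
    by have := congr1 (fun a : 'M_n => a l j) der_invmx; rewrite !mxE.
  have -> : der (Y i l) = \sum_s A s l * Y i s.
    have := congr1 (fun a : 'M_n => a i l) derY; rewrite !mxE => ->.
    by apply: eq_bigr => s _; rewrite mulrC.
  rewrite (mpoly_form_addr _ _ _ _ lg) mulr_suml.
  have -> : form g (\sum_s A s l * Y i s * k) F = \sum_s A s l * B s.
    rewrite (big_morph (fun x => form g x F) (id1 := 0) (op1 := +%R)).
    - by apply: eq_bigr => s _; rewrite -mulrA (mpoly_form_scaler _ _ _ lg).
    - by move=> a b; exact: mpoly_form_addr lg.
    - by have := mpoly_form_scaler y 0 F lg (subfield0 Lsub); rewrite !mul0r; apply.
  by rewrite /D -/(B l); ring.
- move=> g k lg; have -> : psi (p1 + p2) * F = psi p1 * F + psi p2 * F.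
    by rewrite rmorphD mulrDl.
  rewrite 3!mpoly_formD.
  rewrite derD.
  rewrite (IH1 F dF g k lg) (IH2 F dF g k lg).
  exact: addrACA.
- by rewrite rmorphM -mulrA; apply/IH1/IH2.
Qed.

(** The [psi (p k)] are constants of M (x)_L M, so differentiating a relation touches only its
    coefficients. *)
Lemma der_null r (a : 'I_r -> M) (p : 'I_r -> {mpoly C[N]}) :
  J (\sum_k (a k)%:MP * psi (p k)) -> J (\sum_k (der (a k))%:MP * psi (p k)).
Proof.
move=> Jap f m lf.
have formE g x (b : 'I_r -> M) : form g x (\sum_k (b k)%:MP * psi (p k)) =
    \sum_k b k * form g x (psi (p k)).
  by rewrite mpoly_form_sum; apply: eq_bigr => k _; rewrite mpoly_formCM.
have := congr1 (@der M) (Jap f m lf); rewrite der0 formE der_sum.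
rewrite (eq_bigr (fun k => der (a k) * form f m (psi (p k)) +
    (a k * form (commutator f) m (psi (p k)) + a k * form f (der m) (psi (p k))))).
  rewrite !big_split /= -!formE (Jap _ _ (commutator_linear lf)) (Jap _ _ lf).
  by rewrite !addr0.
by move=> k _; rewrite derM der_form_psi // mulrDr.
Qed.

(* Linear disjointness of M and of the constants of M (x)_L M over C. *)
Lemma psi_null_independent r (a : 'I_r -> M) (p : 'I_r -> {mpoly C[N]}) :
    independent kappa a -> J (\sum_k (a k)%:MP * psi (p k)) ->
  forall k, J (psi (p k)).
Proof.
have [_ JD JM] := tensor_null_ideal y L.
elim: r a p => [|r IH] a p aI Jap; first by case.
pose w := widen_ord (leqnSn r).
have al : a ord_max != 0.
  apply/eqP => al; pose e (k : 'I_r.+1) : C := (k == ord_max)%:R.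
  suff /(_ ord_max) : forall k, e k = 0.
    by rewrite /e eqxx => /eqP; rewrite oner_eq0.
  apply: aI; rewrite /e; rewrite (bigD1 ord_max) //= al mulr0 big1 ?addr0 // => k /negPf ->.
  by rewrite rmorph0 mul0r.
pose b k := a k / a ord_max.
have Jbp : J (\sum_k (b k)%:MP * psi (p k)).
  rewrite (_ : \sum_k _ = (a ord_max)^-1%:MP * \sum_k (a k)%:MP * psi (p k)).
    exact: JM.
  rewrite mulr_sumr; apply: eq_bigr => k _.
  by rewrite mulrA -mpolyCM [_^-1 * _]mulrC.
(* With last coefficient 1, differentiation shortens the relation. The remaining derivatives are
   independent: if a C-combination of them is 0, the same combination of the [b (w k)] is a constant
   d, which is a dependence among the [a k]. *)
have Jw k : J (psi (p (w k))).
  apply: (IH (fun k => der (b (w k))) (fun k => p (w k))) => [c c0|]; last first.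
    have := der_null Jbp; rewrite big_ord_recr /= {2}/b divff // der1.
    by rewrite mpolyC0 mul0r addr0.
  have [d dE] : exists d, \sum_k kappa (c k) * b (w k) = kappa d.
    apply: kappa_surj; rewrite der_sum -[RHS]c0; apply: eq_bigr => j _.
    by rewrite derM der_kappa mul0r add0r.
  pose c' (k : 'I_r.+1) := if unlift ord_max k is Some j then c j else - d.
  have c'w j : c' (w j) = c j.
    rewrite /c'; have -> : w j = lift ord_max j.
      by apply: val_inj; rewrite /= /bump leqNgt ltn_ord.
    by rewrite liftK.
  have c'm : c' ord_max = - d by rewrite /c' unlift_none.
  have c'0 : forall k, c' k = 0.
    apply: aI; rewrite big_ord_recr /= c'm rmorphN -dE mulNr mulr_suml -sumrN.
    rewrite -big_split big1 //= => j _; rewrite c'w /b.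
    by rewrite -mulrA divfK // subrr.
  by move=> j; rewrite -c'w.
move=> k; have [j kj|->] := unliftP ord_max k.
  suff -> : k = w j by [].
  by rewrite kj; apply: val_inj; rewrite /= /bump leqNgt ltn_ord.
rewrite (_ : psi _ = (a ord_max)^-1%:MP *
   (\sum_k (a k)%:MP * psi (p k) +
    (-1)%:MP * \sum_k (a (w k))%:MP * psi (p (w k)))).
  apply/JM/JD => //; apply: (JM); apply: (big_ind J) => // [|j _]; last exact: JM.
  by case: (tensor_null_ideal y L).
rewrite big_ord_recr /= mpolyCN mpolyC1 mulN1r [_ + _ - _]addrC addKr mulrA -mpolyCM.
by rewrite mulVf // mpolyC1 mul1r.
Qed.

End over_subfield.

(** As X = Z Y, the entries of Z generate M[X] over M. Coefficients that depend over C on the others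
    are eliminated one at a time. *)
Lemma psi_expansion (F : {mpoly M[N]}) :
  exists r (a : 'I_r -> M) (p : 'I_r -> {mpoly C[N]}),
    independent kappa a /\ F = \sum_k (a k)%:MP * psi (p k).
Proof.
suff [s ->] : exists s : seq (M * {mpoly C[N]}), F = \sum_(z <- s) z.1%:MP * psi z.2.
  rewrite (big_nth (0, 0)) big_mkord.
  set a0 := fun k => (nth (0, 0) s k).1; set p0 := fun k => (nth (0, 0) s k).2.
  suff: forall r (a : 'I_r -> M) (p : 'I_r -> {mpoly C[N]}),
     exists r' (a' : 'I_r' -> M) (p' : 'I_r' -> {mpoly C[N]}), independent kappa a' /\
     \sum_k (a k)%:MP * psi (p k) = \sum_k (a' k)%:MP * psi (p' k).
    by move=> /(_ _ (fun k => a0 k) (fun k => p0 k)).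
  elim=> [|r IH] a p; first by exists 0%N, a, p; split=> // c _ [].
  have [aI|] := pselect (independent kappa a); first by exists r.+1, a, p.
  move=> /existsNP[c /not_implyP[c0 /existsNP[j /eqP cj]]].
  have [r' [a' [p' [a'I e]]]] := IH (fun k => a (lift j k))
    (fun k => p (lift j k) - (c (lift j k) / c j)%:MP * p j).
  exists r', a', p'; split=> //; rewrite -e (bigD1_ord j) //=.
  have kcj : kappa (c j) != 0 by rewrite fmorph_eq0.
  have aj : a j = - \sum_k kappa (c (lift j k)) / kappa (c j) * a (lift j k).
    move: c0; rewrite (bigD1_ord j) //= => /eqP; rewrite addr_eq0 => /eqP c0.
    apply: (mulfI kcj); rewrite c0 mulrN mulr_sumr; congr (- _).
    by apply: eq_bigr => k _; rewrite mulrA mulrCA divff // mulr1.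
  rewrite aj mpolyCN mulNr rmorph_sum mulr_suml -sumrN -big_split.
  apply: eq_bigr => k _ /=.
  have psiBM d q q' : psi (q - d%:MP * q') = psi q - (kappa d)%:MP * psi q'.
    by rewrite -psiC -rmorphM -rmorphB.
  by rewrite psiBM fmorph_div mpolyCM; ring.
elim: (mpoly_overT F) => [c _|k|p q _ [s ->] _ [t ->]|p q _ [s ->] _ [t ->]].
- by exists [:: (c, 1)]; rewrite big_seq1 rmorph1 mulr1.
- case/mxvec_indexP: k => i j.
  exists [seq (Y l j, 'X_(idx i l)) | l <- index_enum _]; rewrite big_map /=.
  transitivity (\sum_s \sum_l (W s l * Y l j)%:MP * 'X_(idx i s) : {mpoly M[N]}).
    rewrite (bigD1 j) //= -mulr_suml -rmorph_sum /=.
    have WY s : \sum_l W s l * Y l j = (s == j)%:R.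
      by have := mulVmx Yunit => /(congr1 (fun a : 'M_n => a s j)); rewrite !mxE.
    rewrite WY eqxx mpolyC1 mul1r big1 ?addr0 // => s /negPf sj.
    by rewrite -mulr_suml -rmorph_sum /= WY sj mpolyC0 mul0r.
  rewrite exchange_big; apply: eq_bigr => l _ /=; rewrite psiX mulr_sumr.
  by apply: eq_bigr => s _; rewrite mpolyCM; ring.
- by exists (s ++ t); rewrite big_cat.
- exists [seq (z.1 * z'.1, z.2 * z'.2) | z <- s, z' <- t]; rewrite big_allpairs_dep.
  rewrite mulr_suml; apply: eq_bigr => z _; rewrite mulr_sumr; apply: eq_bigr => z' _.
  by rewrite /= mpolyCM rmorphM /=; ring.
Qed.

End linear_system.

(** * Translations by constant matrices *)

Section translation.
Variables (M C : fieldType) (kappa : {rmorphism C -> M}) (n : nat).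
Local Notation N := (n * n)%N.

Definition translate (c : 'M[C]_n) : 'M[M]_n -> 'M[M]_n := mulmx (map_mx kappa c).

Lemma translateVK c : c \in unitmx -> cancel (translate c) (translate (invmx c)).
Proof. by move=> cu V; rewrite /translate mulmxA -map_mxM mulVmx // map_mx1 mul1mx. Qed.

(** f lies in the M-span of finitely many functions on which translation acts by a matrix over C. A
    spanning family suffices; sums and products of functions use disjoint unions and products of the
    index types. *)
Definition locally_finite (c : 'M[C]_n) (f : 'M[M]_n -> M) : Prop :=
  exists (T : finType) (a : T -> M) (g : T -> 'M[M]_n -> M) (w : T -> T -> C),
    (forall V, f V = \sum_t a t * g t V) /\
    (forall t V, g t (translate c V) = \sum_s kappa (w t s) * g s V).

Lemma mpoly_locally_finite (c : 'M[C]_n) (F : {mpoly M[N]}) :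
  locally_finite c (fun V => F.@[mxvec V 0]).
Proof.
elim: (mpoly_overT F) => [x _|k|p q _ [T [a [g [w [fE gE]]]]] _ [T' [a' [g' [w' [fE' gE']]]]]
  |p q _ [T [a [g [w [fE gE]]]]] _ [T' [a' [g' [w' [fE' gE']]]]]].
- exists unit, (fun=> x), (fun _ _ => 1), (fun _ _ => 1).
  have sum1 (G : unit -> M) : \sum_t G t = G tt.
    by rewrite (bigD1 tt) //= big1 ?addr0 // => -[].
  by split=> [V|t V]; rewrite sum1 ?mevalC ?rmorph1 mulr1.
- case/mxvec_indexP: k => i j.
  exists 'I_n, (fun l => (l == i)%:R), (fun l V => V l j), c; split=> [V|l V].
    rewrite (bigD1 i) //= eqxx mul1r mevalXU mxvecE big1 ?addr0 // => l /negPf ->.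
    by rewrite mul0r.
  by rewrite mxE; apply: eq_bigr => s _; rewrite mxE.
- exists (T + T')%type, (fun t => match t with inl t => a t | inr t => a' t end),
    (fun t => match t with inl t => g t | inr t => g' t end),
    (fun t s => match t, s with inl t, inl s => w t s | inr t, inr s => w' t s
                | _, _ => 0 end).
  split=> [V|t V]; rewrite big_sumType /=; first by rewrite mevalD fE fE'.
  case: t => t; rewrite ?gE ?gE'.
    by rewrite [X in _ + X]big1 ?addr0 // => s _; rewrite rmorph0 mul0r.
  by rewrite [X in X + _]big1 ?add0r // => s _; rewrite rmorph0 mul0r.
- exists (T * T')%type, (fun t => a t.1 * a' t.2), (fun t V => g t.1 V * g' t.2 V),
    (fun t s => w t.1 s.1 * w' t.2 s.2).
  split=> [V|t V].
    rewrite mevalM fE fE' mulr_suml -(pair_bigA _ (fun t s => a t * a' s * (g t V * g' s V))).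
    by apply: eq_bigr => t _; rewrite mulr_sumr; apply: eq_bigr => s _ /=; ring.
  rewrite gE gE' mulr_suml -(pair_bigA _ (fun s s' => kappa (w t.1 s * w' t.2 s') *
    (g s V * g' s' V))).
  apply: eq_bigr => s _; rewrite mulr_sumr; apply: eq_bigr => s' _ /=.
  by rewrite rmorphM; ring.
Qed.

(** chi is the characteristic polynomial of the matrix w of [locally_finite], which does not depend
    on V. *)
Lemma translation_recurrence (c : 'M[C]_n) (F : {mpoly M[N]}) :
  exists2 chi : {poly C}, chi \is monic & forall V,
    \sum_(k < size chi) kappa chi`_k * F.@[mxvec (iter k (translate c) V) 0] = 0.
Proof.
have [T [a [g [w [fE gE]]]]] := mpoly_locally_finite c F.
have sumT (F' : T -> M) : \sum_t F' t = \sum_(i < #|T|) F' (enum_val i).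
  exact: (reindex _ (onW_bij _ (enum_val_bij T))).
pose Wm : 'M[C]_#|T| := \matrix_(i, j) w (enum_val i) (enum_val j).
pose G V : 'cV[M]_#|T| := \col_i g (enum_val i) V.
pose b : 'rV[M]_#|T| := \row_i a (enum_val i).
have {}fE V : F.@[mxvec V 0] = (b *m G V) 0 0.
  rewrite fE mxE sumT.
  by apply: eq_bigr => i _; rewrite !mxE.
have {}gE V : G (translate c V) = map_mx kappa Wm *m G V.
  apply/colP => i; rewrite !mxE gE sumT.
  by apply: eq_bigr => j _; rewrite !mxE.
move: #|T| Wm G b fE gE => [|d] Wm G b fE gE.
  exists 1 => [|V]; first exact: monic1.
  by rewrite big1 // => k _; rewrite fE mxE big_ord0 mulr0.
exists (char_poly Wm) => [|V]; first exact: char_poly_monic.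
have Gk k : G (iter k (translate c) V) = map_mx kappa (Wm ^+ k) *m G V.
  elim: k => [|k IH]; first by rewrite expr0 map_mx1 mul1mx.
  by rewrite iterS gE IH mulmxA -map_mxM mulmxE -exprS.
have := Cayley_Hamilton Wm; rewrite -{1}[char_poly Wm]coefK poly_def linear_sum /= => CH.
transitivity ((b *m map_mx kappa (0 : 'M_d.+1) *m G V) 0 0); last first.
  by rewrite map_mx0 mulmx0 mul0mx mxE.
rewrite -CH map_mx_sum mulmx_sumr mulmx_suml summxE; apply: eq_bigr => k _.
rewrite linearZ /= rmorphXn /= horner_mx_X map_mxZ -scalemxAr -scalemxAl mxE.
by rewrite fE Gk mulmxA.
Qed.

Variable L : set M.
Hypothesis Lkappa : forall c, L (kappa c).

Lemma mpoly_over_translate (c : 'M[C]_n) (F : {mpoly M[N]}) : mpoly_over L F ->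
  exists2 F', mpoly_over L F' & forall V, F'.@[mxvec V 0] = F.@[mxvec (translate c V) 0].
Proof.
elim=> [x Lx|k|p q _ [p' Lp pE] _ [q' Lq qE]|p q _ [p' Lp pE] _ [q' Lq qE]].
- by exists x%:MP => [|V]; [exact: mpoly_overC|rewrite !mevalC].
- case/mxvec_indexP: k => i j.
  exists (0%:MP + \sum_l (kappa (c i l))%:MP * 'X_(mxvec_index l j)).
    elim/big_rec: _ => [|l p _].
      by rewrite addr0 -(rmorph0 kappa); exact: mpoly_overC.
    rewrite addrCA; apply: mpoly_overD; apply: mpoly_overM.
      exact: mpoly_overC.
    exact: mpoly_overX.
  move=> V; rewrite mpolyC0 add0r rmorph_sum /= mevalXU mxvecE mxE.
  by apply: eq_bigr => l _; rewrite mevalM mevalC mevalXU mxvecE mxE.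
- by exists (p' + q') => [|V]; [exact: mpoly_overD|rewrite !mevalD pE qE].
- by exists (p' * q') => [|V]; [exact: mpoly_overM|rewrite !mevalM pE qE].
Qed.

(* F is recovered from its translates under c, c^2, ... by Cayley-Hamilton for c^-1. *)
Lemma relations_preserved_reflected (c : 'M[C]_n) (Y : 'M[M]_n) : c \in unitmx ->
    (forall F, mpoly_over L F -> F.@[mxvec Y 0] = 0 ->
       F.@[mxvec (translate c Y) 0] = 0) ->
  forall F, mpoly_over L F -> F.@[mxvec (translate c Y) 0] = 0 -> F.@[mxvec Y 0] = 0.
Proof.
move=> cu pres F LF FcY.
have iterF k : F.@[mxvec (iter k.+1 (translate c) Y) 0] = 0.
  elim: k F LF FcY => // k IH F LF FcY.
  have [F' LF' F'E] := mpoly_over_translate c LF.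
  rewrite iterS -F'E; apply: IH => //; apply: pres => //.
  by rewrite F'E.
have [chi mchi chi0] := translation_recurrence (invmx c) F.
(* At c^d Y, with d the degree of chi, the k-th term is a multiple of F(c^(d-k) Y). It vanishes for
   k < d, and the term k = d is F(Y) because chi is monic. *)
have := chi0 (iter (size chi).-1 (translate c) Y).
have s0 : (0 < size chi)%N by rewrite size_poly_gt0 monic_neq0.
have iterK k l : (k <= l)%N ->
    iter k (translate (invmx c)) (iter l (translate c) Y) = iter (l - k) (translate c) Y.
  elim: k => [|k IH] kl; first by rewrite subn0.
  rewrite iterS IH ?(ltnW kl) // -[(l - k)%N]prednK ?subn_gt0 // iterS.
  by rewrite translateVK // subnS.
move: mchi chi0 iterK; rewrite monicE lead_coefE.
case: (size chi) s0 => // d _ /= /eqP cd _ iterK.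
rewrite big_ord_recr /= cd rmorph1 mul1r iterK // subnn /= big1 ?add0r // => k _.
rewrite iterK; last exact: ltnW.
by rewrite -[(d - k)%N]prednK ?subn_gt0 // iterF mulr0.
Qed.

End translation.

(** * Automorphisms of a Picard-Vessiot extension *)

Lemma diff_gal_rmorphism (M : diffFieldType) (L : set M) (sigma : M -> M) :
  diff_gal L sigma -> exists s : {rmorphism M -> M}, s = sigma :> (M -> M).
Proof.
case=> sZ sM _ _ _.
pose mZ := GRing.isZmodMorphism.Build M M sigma sZ.
pose mM := GRing.isMonoidMorphism.Build M M sigma sM.
by exists (HB.pack_for {rmorphism M -> M} sigma mZ mM).
Qed.

Lemma mpoly_over_eval (M : fieldType) (N : nat) (L : set M) (s : {rmorphism M -> M})
    (v : 'I_N -> M) (F : {mpoly M[N]}) : (forall l, L l -> s l = l) ->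
  mpoly_over L F -> s F.@[v] = F.@[s \o v].
Proof.
move=> sL; elim=> [x Lx|k|p q _ pE _ qE|p q _ pE _ qE].
- by rewrite !mevalC sL.
- by rewrite !mevalXU.
- by rewrite !mevalD rmorphD pE qE.
- by rewrite !mevalM rmorphM pE qE.
Qed.

Section closure.
Variables (R : comNzRingType) (N : nat) (S : set R).
Hypotheses (S1 : S 1) (SN1 : S (-1)).

Lemma mpoly_over1 : mpoly_over S (1 : {mpoly R[N]}).
Proof. by rewrite -mpolyC1; exact: mpoly_overC. Qed.

Lemma mpoly_overN (p : {mpoly R[N]}) : mpoly_over S p -> mpoly_over S (- p).
Proof.
move=> Sp; rewrite -mulN1r -mpolyC1 -mpolyCN; apply: mpoly_overM => //.
exact: mpoly_overC.
Qed.

Lemma mpoly_overB (p q : {mpoly R[N]}) :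
  mpoly_over S p -> mpoly_over S q -> mpoly_over S (p - q).
Proof. by move=> Sp Sq; apply: mpoly_overD => //; exact: mpoly_overN. Qed.

Lemma mpoly_over_det (n : nat) (a : 'M[{mpoly R[N]}]_n) :
  (forall i j, mpoly_over S (a i j)) -> mpoly_over S (\det a).
Proof.
move=> Sa; rewrite /determinant; apply: (big_ind (@mpoly_over N R S)).
- by rewrite -(subrr 1); apply: mpoly_overB; exact: mpoly_over1.
- by move=> p q; exact: mpoly_overD.
move=> s _; apply: mpoly_overM.
  by case: (perm.odd_perm s); rewrite ?expr1 ?expr0; [apply: mpoly_overN|]; exact: mpoly_over1.
apply: (big_ind (@mpoly_over N R S)) => [|p q|i _].
- exact: mpoly_over1.
- exact: mpoly_overM.
- exact: Sa.
Qed.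

End closure.

Definition generic_det (R : comNzRingType) (n : nat) : {mpoly R[n * n]} :=
  \det (\matrix_(i < n, j < n) 'X_(mxvec_index i j)).

Lemma meval_generic_det (R : comNzRingType) (n : nat) (c : 'M[R]_n) :
  (generic_det R n).@[mxvec c 0] = \det c.
Proof.
rewrite /generic_det -[LHS](det_map_mx (meval (mxvec c 0))); congr (\det _).
by apply/matrixP => i j; rewrite !mxE /= mevalXU mxvecE.
Qed.

Section galois.
Variables (M : diffFieldType) (C : fieldType) (kappa : {rmorphism C -> M}).
Variables (n : nat) (Y A : 'M[M]_n).
Hypothesis der_kappa : forall c, der (kappa c) = 0.
Hypothesis kappa_surj : forall x : M, der x = 0 -> exists c, x = kappa c.
Hypothesis Yunit : Y \in unitmx.
Hypothesis derY : map_mx der Y = Y *m A.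

Local Notation N := (n * n)%N.
Local Notation y := (mxvec Y 0).
Local Notation trans := (translate kappa).

(** Both s Y and Y solve V' = V A, so s Y * Y^-1 has derivative zero. *)
Lemma automorphism_matrix (s : {rmorphism M -> M}) : {morph s : x / der x} ->
    (forall i j, s (A i j) = A i j) ->
  exists2 c, c \in unitmx & map_mx s Y = trans c Y.
Proof.
move=> sder sA; pose B := map_mx s Y *m invmx Y.
have sdY : map_mx der (map_mx s Y) = map_mx s Y *m A.
  have <- : map_mx s A = A by apply/matrixP => i j; rewrite mxE sA.
  by rewrite -map_mxM -derY; apply/matrixP => i j; rewrite !mxE sder.
have dB : map_mx der B = 0.
  rewrite der_mulmx sdY -mulmxA.
  have dV : map_mx der (invmx Y) = - (A *m invmx Y) by exact: (der_invmx Yunit derY).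
  by rewrite dV mulmxN subrr.
have cE i j : exists d, B i j = kappa d.
  by apply: kappa_surj; have := congr1 (fun a : 'M_n => a i j) dB; rewrite !mxE.
pose c := \matrix_(i, j) sval (cid (cE i j)).
have kc : map_mx kappa c = B.
  by apply/matrixP => i j; rewrite !mxE; case: cid.
exists c; last by rewrite /translate kc /B mulmxKV.
rewrite unitmxE unitfE -(fmorph_eq0 kappa) -det_map_mx kc det_mulmx det_inv.
by rewrite det_map_mx mulf_neq0 ?invr_eq0 ?fmorph_eq0 // -unitfE -unitmxE.
Qed.

(** The functional a (x) b |-> a * s b is multiplicative; it carries X to c Y, hence Z to c. *)
Lemma mpoly_form_automorphism (s : {rmorphism M -> M}) (c : 'M[C]_n) p :
  map_mx s Y = trans c Y ->
  mpoly_form y s 1 (psi kappa Y p) = kappa p.@[mxvec c 0].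
Proof.
move=> sY; rewrite -(meval_psi kappa Yunit) -/(translate kappa c Y) -sY /mpoly_form mevalE.
apply: eq_bigr => k _; congr (_ * _); rewrite mulr1 mevalX rmorph_prod /=.
apply: eq_bigr => i _; rewrite rmorphXn /=.
by congr (_ ^+ _); case/mxvec_indexP: i => i j; rewrite !mxvecE mxE.
Qed.

Section over_subfield.
Variable L : set M.
Hypothesis Lsub : subfield L.
Hypothesis Lder : forall x, L x -> L (der x).
Hypothesis LA : forall i j, L (A i j).
Hypothesis Lkappa : forall c, L (kappa c).
Hypothesis gen : forall x, exists F G : {mpoly M[N]}, [/\ mpoly_over L F,
  mpoly_over L G, G.@[y] != 0 & x = F.@[y] / G.@[y]].

Let L1 : L 1. Proof. by case: Lsub. Qed.
Let LN1 : L (-1). Proof. exact: subfieldN. Qed.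

(** F' is F differentiated under the rule X' = X A; being the same for every V, it serves at Y and
    at c Y alike. *)
Lemma mpoly_over_der (F : {mpoly M[N]}) : mpoly_over L F ->
  exists2 F', mpoly_over L F' & forall V : 'M[M]_n, map_mx der V = V *m A ->
    der F.@[mxvec V 0] = F'.@[mxvec V 0].
Proof.
elim=> [x Lx|k|p q Lp [p' Lp' pE] Lq [q' Lq' qE]|p q Lp [p' Lp' pE] Lq [q' Lq' qE]].
- by exists (der x)%:MP => [|V _]; [apply: mpoly_overC; exact: Lder|rewrite !mevalC].
- case/mxvec_indexP: k => i j.
  exists (0%:MP + \sum_l (A l j)%:MP * 'X_(mxvec_index i l)).
    elim/big_rec: _ => [|l p _].
      by rewrite addr0; apply: mpoly_overC; exact: subfield0.
    rewrite addrCA; apply: mpoly_overD; apply: mpoly_overM.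
      exact: mpoly_overC.
    exact: mpoly_overX.
  move=> V dV; rewrite mpolyC0 add0r rmorph_sum /= mevalXU mxvecE.
  have := congr1 (fun a : 'M_n => a i j) dV; rewrite !mxE => ->.
  by apply: eq_bigr => l _; rewrite mevalM mevalC mevalXU mxvecE mulrC.
- exists (p' + q'); first exact: mpoly_overD.
  by move=> V dV; rewrite !mevalD derD pE ?qE.
- exists (p' * q + p * q'); first by apply: mpoly_overD; exact: mpoly_overM.
  by move=> V dV; rewrite !mevalD !mevalM derM pE ?qE.
Qed.

(** sigma substitutes c Y for Y in fractions F(Y) / G(Y). Preservation of relations makes the value
    independent of the fraction; their reflection keeps denominators nonzero. *)
Lemma extend_translation (c : 'M[C]_n) : c \in unitmx ->
    (forall F, mpoly_over L F -> F.@[y] = 0 -> F.@[mxvec (trans c Y) 0] = 0) ->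
  exists2 sigma, diff_gal L sigma & map_mx sigma Y = trans c Y.
Proof.
move=> cu pres; have refl := relations_preserved_reflected Lkappa cu pres.
pose z := mxvec (trans c Y) 0.
have nz G : mpoly_over L G -> G.@[y] != 0 -> G.@[z] != 0.
  by move=> LG; apply: contra_neq; exact: refl.
have def x : exists x', exists F G, [/\ mpoly_over L F, mpoly_over L G, G.@[y] != 0,
    x = F.@[y] / G.@[y] & x' = F.@[z] / G.@[z]].
  by have [F [G [LF LG G0 xE]]] := gen x; exists (F.@[z] / G.@[z]), F, G.
pose sigma x := sval (cid (def x)).
have sE F G : mpoly_over L F -> mpoly_over L G -> G.@[y] != 0 ->
    sigma (F.@[y] / G.@[y]) = F.@[z] / G.@[z].
  move=> LF LG G0; rewrite /sigma; case: cid => x' /= [F' [G' [LF' LG' G'0 e ->]]].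
  have [Gz G'z] := (nz _ LG G0, nz _ LG' G'0).
  apply/eqP; rewrite eqr_div // -subr_eq0 -!mevalM -mevalB; apply/eqP/pres.
    by apply: mpoly_overB => //; exact: mpoly_overM.
  by rewrite mevalB !mevalM; move/eqP: e; rewrite eqr_div // => /eqP ->; rewrite subrr.
have sE1 F : mpoly_over L F -> sigma F.@[y] = F.@[z].
  move=> LF; have := sE F 1 LF (mpoly_over1 _ L1); rewrite !meval1 !divr1.
  by apply; exact: oner_neq0.
have derYz : map_mx der (trans c Y) = trans c Y *m A.
  rewrite /translate der_mulmx derY mulmxA [map_mx der _](_ : _ = 0) ?mul0mx ?add0r //.
  by apply/matrixP => i j; rewrite !mxE.
have sB : zmod_morphism sigma.
  move=> x x'; have [[F [G [LF LG G0 ->]]] [F' [G' [LF' LG' G'0 ->]]]] := (gen x, gen x').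
  have [Gz G'z] := (nz _ LG G0, nz _ LG' G'0).
  have -> : F.@[y] / G.@[y] - F'.@[y] / G'.@[y] =
      (F * G' - F' * G).@[y] / (G * G').@[y].
    by rewrite mevalB !mevalM; field; rewrite G0 G'0.
  rewrite !sE //.
  - by rewrite mevalB !mevalM; field; rewrite Gz G'z.
  - by apply: mpoly_overB => //; exact: mpoly_overM.
  - exact: mpoly_overM.
  - by rewrite mevalM mulf_neq0.
have sM : monoid_morphism sigma.
  split=> [|x x']; first by have := sE1 1 (mpoly_over1 _ L1); rewrite !meval1.
  have [[F [G [LF LG G0 ->]]] [F' [G' [LF' LG' G'0 ->]]]] := (gen x, gen x').
  have [Gz G'z] := (nz _ LG G0, nz _ LG' G'0).
  have -> : F.@[y] / G.@[y] * (F'.@[y] / G'.@[y]) = (F * F').@[y] / (G * G').@[y].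
    by rewrite !mevalM; field; rewrite G0 G'0.
  rewrite !sE //.
  - by rewrite !mevalM; field; rewrite Gz G'z.
  - exact: mpoly_overM.
  - exact: mpoly_overM.
  - by rewrite mevalM mulf_neq0.
pose mZ := GRing.isZmodMorphism.Build M M sigma sB.
pose mM := GRing.isMonoidMorphism.Build M M sigma sM.
pose s : {rmorphism M -> M} := HB.pack_for {rmorphism M -> M} sigma mZ mM.
exists sigma; last first.
  apply/matrixP => i j; rewrite mxE -[Y i j](mxvecE Y) -mevalXU sE1; last exact: mpoly_overX.
  by rewrite mevalXU /z mxvecE.
split=> //; last by move=> l Ll; have := sE1 l%:MP (mpoly_overC _ Ll); rewrite !mevalC.
(* Substituting c^-1 Y for Y produces a preimage. *)
have /choice[g gK] : forall x, exists x', sigma x' = x.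
    move=> x; have [F [G [LF LG G0 ->]]] := gen x.
    have [F' LF' F'E] := mpoly_over_translate Lkappa (invmx c) LF.
    have [G' LG' G'E] := mpoly_over_translate Lkappa (invmx c) LG.
    have G'z : G'.@[z] = G.@[y] by rewrite /z G'E translateVK.
    exists (F'.@[y] / G'.@[y]); rewrite sE //.
      by rewrite G'z /z F'E translateVK.
    by apply: contra_neq G0 => /(pres _ LG'); rewrite -/z G'z.
  by exists g => // x; apply: (fmorph_inj s); rewrite /= gK.
move=> x; have [F [G [LF LG G0 ->]]] := gen x; have Gz := nz _ LG G0.
have [F' LF' F'E] := mpoly_over_der LF; have [G' LG' G'E] := mpoly_over_der LG.
have -> : der (F.@[y] / G.@[y]) = (F' * G - F * G').@[y] / (G * G).@[y].
  rewrite derM derV // F'E // G'E // mevalB !mevalM; field; exact: G0.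
rewrite !sE //; first 1 last.
- by apply: mpoly_overB => //; exact: mpoly_overM.
- exact: mpoly_overM.
- by rewrite mevalM mulf_neq0.
rewrite derM derV // F'E // G'E // mevalB !mevalM; field; exact: Gz.
Qed.

Local Notation J := (tensor_null y L).

Lemma relation_null F : mpoly_over L F -> F.@[y] = 0 -> J F.
Proof.
move=> LF F0 f m lf; rewrite -[F]mulr1 (mpoly_form_overM _ _ _ lf LF) F0 mul0r.
by rewrite -mpolyC1 mpoly_formC mul1r -(mul0r 0) lf.2 ?mul0r //; exact: subfield0.
Qed.

(** F is null in M (x)_L M, so linear disjointness makes each [psi (p k)] of its expansion null. At
    X = c Y these take the values of the [p k] at c, which vanish. *)
Lemma translation_preserves_relations (c : 'M[C]_n) :
    (forall p, J (psi kappa Y p) -> p.@[mxvec c 0] = 0) ->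
  forall F, mpoly_over L F -> F.@[y] = 0 -> F.@[mxvec (trans c Y) 0] = 0.
Proof.
move=> Jc F LF F0; have [r [a [p [aI FE]]]] := psi_expansion kappa Yunit F.
have JF := relation_null LF F0; rewrite FE in JF.
have Jp := psi_null_independent der_kappa kappa_surj Yunit derY Lsub Lder LA aI JF.
rewrite FE rmorph_sum big1 //= => k _.
by rewrite mevalM mevalC meval_psi // Jc ?rmorph0 ?mulr0 //; exact: Jp.
Qed.

Lemma psi_generic_det :
  psi kappa Y (generic_det C n) = (\det (invmx Y))%:MP * generic_det M n.
Proof.
rewrite -[LHS](det_map_mx (psi kappa Y)).
rewrite (_ : map_mx _ _ = generic_matrix Y).
  by rewrite /generic_matrix det_mulmx det_map_mx mulrC.
apply/matrixP => i j; rewrite !mxE /= psiX; apply: eq_bigr => l _.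
by rewrite !mxE mulrC.
Qed.

Lemma linear_over_twist x f : linear_over L f -> linear_over L (twist x f).
Proof.
case=> fD fZ; split=> [a b|l a Ll]; rewrite /twist.
  by rewrite mulrDr !fD; ring.
by rewrite [x * (l * a)]mulrCA !(fZ l) //; ring.
Qed.

(* The image in M (x)_L M of the polynomial below is a unit times 1 (x) x - x (x) 1,
   where x = P(Y) / Q(Y). *)
Lemma mpoly_form_difference x P Q f m k F : mpoly_over L P -> mpoly_over L Q ->
    P.@[y] = x * Q.@[y] -> linear_over L f ->
  mpoly_form y f m
    (((Q.@[y]%:MP * P - P.@[y]%:MP * Q) * psi kappa Y (generic_det C n)) ^+ k * F) =
  (\det (invmx Y) * Q.@[y]) ^+ k *
  mpoly_form y (iter k (twist x) f) ((\det Y * Q.@[y]) ^+ k * m) F.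
Proof.
move=> LP LQ xE; set q := Q.@[y]; set h := _ - _; rewrite psi_generic_det.
have LD : mpoly_over L (generic_det M n).
  by apply: mpoly_over_det => // i j; rewrite mxE; exact: mpoly_overX.
(* h stands for q (x) q times 1 (x) x - x (x) 1. *)
have formh g m' G : linear_over L g ->
    mpoly_form y g m' (h * G) = q * mpoly_form y (twist x g) (q * m') G.
  move=> lg; rewrite /h mulrBl -!mulrA -mulN1r -mpolyC1 -mpolyCN.
  rewrite mpoly_formD !mpoly_formCM !(mpoly_form_overM _ _ _ lg) // -/q xE.
  rewrite /mpoly_form !(@mulr_sumr _ _ (msupp G)) -big_split; apply: eq_bigr => j _ /=.
  rewrite /twist.
  have -> : x * ('X_[j].@[y] * (q * m')) = 'X_[j].@[y] * (x * q * m') by ring.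
  by ring.
elim: k f m => [|k IH] f m lf; first by rewrite !expr0 !mul1r.
rewrite exprS -!mulrA formh // mpoly_formCM (mpoly_form_overM _ _ _ _ LD); last first.
  exact: linear_over_twist.
rewrite meval_generic_det IH; last exact: linear_over_twist.
rewrite -iterSr !exprS; set mm := (X in mpoly_form _ _ X).
have -> : mm = \det Y * q * (\det Y * q) ^+ k * m by rewrite /mm; ring.
by ring.
Qed.

(** The factor [psi kappa Y (generic_det C n)] is det Z, a unit of M (x)_L M. Including it ensures
    that det Z stays nonzero in the field chosen later. *)
Lemma difference_not_nilpotent x P Q k : [pchar M] =i pred0 ->
    mpoly_over L P -> mpoly_over L Q -> Q.@[y] != 0 -> x = P.@[y] / Q.@[y] -> ~ L x ->
  ~ J (((Q.@[y]%:MP * P - P.@[y]%:MP * Q) * psi kappa Y (generic_det C n)) ^+ k).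
Proof.
move=> char0 LP LQ Q0 xE nLx Jk; apply: nLx; apply: (twist_nilpotent Lsub (n := k) char0).
have PE : P.@[y] = x * Q.@[y] by rewrite xE divfK.
have detY : \det Y != 0 by rewrite -unitfE -unitmxE.
have detW : \det (invmx Y) != 0 by rewrite det_inv invr_eq0.
have uq : (\det Y * Q.@[y]) ^+ k != 0 by rewrite expf_neq0 ?mulf_neq0.
(* This argument cancels the unit in the second tensor factor and leaves the iterated twist at m. *)
move=> f m lf; have := Jk f (((\det Y * Q.@[y]) ^+ k)^-1 * m) lf.
rewrite -[X in mpoly_form _ _ _ X]mulr1 (mpoly_form_difference _ _ _ LP LQ PE lf).
rewrite -mpolyC1 mpoly_formC mul1r mulVKf // => /eqP.
by rewrite mulf_eq0 expf_eq0 mulf_eq0 (negPf detW) (negPf Q0) andbF => /eqP.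
Qed.

Lemma fixed_field x : GRing.closed_field_axiom C -> [pchar M] =i pred0 ->
  (forall sigma, diff_gal L sigma -> sigma x = x) -> L x.
Proof.
move=> closedC char0 fixx; apply: contrapT => nLx.
have [P [Q [LP LQ Q0 xE]]] := gen x.
pose h := Q.@[y]%:MP * P - P.@[y]%:MP * Q.
have [E [phi [phiJ phih]]] := field_avoiding (tensor_null_ideal y L)
  (fun k => difference_not_nilpotent char0 LP LQ Q0 xE nLx (k := k)).
have [r [a [p [aI hE]]]] := psi_expansion kappa Yunit h.
rewrite -/h rmorphM mulf_eq0 negb_or /= in phih; case/andP: phih => phih phid.
have [k pk] : exists k, phi (psi kappa Y (p k)) != 0.
  apply: contrapT => /forallNP np; move/eqP: phih; apply.
  rewrite hE rmorph_sum big1 // => k _; rewrite rmorphM /=.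
  by have /negP/negPn/eqP -> := np k; rewrite mulr0.
pose kE : {rmorphism C -> E} := phi \o (@mpolyC N M \o kappa).
pose t i := phi (psi kappa Y 'X_i).
have tE f : mmap kE t f = phi (psi kappa Y f).
  apply: (@mpoly_rmorph_eq _ _ _ (mmap kE t) (phi \o psi kappa Y)) => [c|i] /=.
    by rewrite mmapC psiC.
  by rewrite mmapX mmap1U.
(* This b keeps both [p k] and the determinant nonzero at the specialized matrix. *)
have [|xi [xirel xi0]] := specialization (kappa := kE) (t := t)
    (b := p k * generic_det C n) closedC.
  by rewrite tE !rmorphM mulf_neq0.
pose c : 'M[C]_n := vec_mx (\row_i xi i).
have cE f : f.@[mxvec c 0] = f.@[xi].
  by apply: meval_eq => i; rewrite /c vec_mxK mxE.
have cu : c \in unitmx.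
  move: xi0; rewrite mevalM -!cE meval_generic_det mulf_eq0 negb_or => /andP[_].
  by rewrite -unitfE -unitmxE.
have pkc : (p k).@[mxvec c 0] != 0.
  by move: xi0; rewrite mevalM -!cE mulf_eq0 negb_or => /andP[].
have [|sigma Gs sY] := extend_translation cu.
  by apply: translation_preserves_relations => f Jf; rewrite cE; apply: xirel; rewrite tE phiJ.
have [s sE] := diff_gal_rmorphism Gs.
have sL l : L l -> s l = l by rewrite sE; case: Gs => _ _ _ _; apply.
have sF F : mpoly_over L F -> s F.@[y] = F.@[mxvec (trans c Y) 0].
  move=> LF; rewrite (mpoly_over_eval _ sL LF); apply: meval_eq => i.
  by case/mxvec_indexP: i => i j; rewrite /= !mxvecE -sY mxE sE.
(* With q = Q(Y), h(c Y) = q * (s (x * q) - x * s q), and s fixes x. But h(c Y) is also the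
   combination of the [a k] with coefficients [p k] at c, so independence contradicts [pkc]. *)
have hc : h.@[mxvec (trans c Y) 0] = 0.
  rewrite mevalB !mevalM !mevalC -!sF //.
  have -> : P.@[y] = x * Q.@[y] by rewrite xE divfK.
  by rewrite rmorphM sE (fixx _ Gs); ring.
move/eqP: pkc; apply; apply: (aI (fun k => (p k).@[mxvec c 0])).
rewrite -[RHS]hc hE rmorph_sum /=; apply: eq_bigr => j _.
by rewrite mevalM mevalC meval_psi // mulrC.
Qed.

(** Automorphisms over L are L-linear functionals, so a p with [psi kappa Y p] null vanishes at all
    their matrices, hence at c. *)
Lemma zariski_closure_gal (c : 'M[C]_n) : c \in unitmx ->
    (forall p : {mpoly C[N]}, (forall tau d, diff_gal L tau -> map_mx tau Y = trans d Y ->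
       p.@[mxvec d 0] = 0) -> p.@[mxvec c 0] = 0) ->
  exists2 sigma, diff_gal L sigma & map_mx sigma Y = trans c Y.
Proof.
move=> cu closure; apply: extend_translation cu _.
apply: translation_preserves_relations => p Jp.
apply: closure => tau d Gt tY.
have [s sE] := diff_gal_rmorphism Gt.
have sL l : L l -> s l = l by rewrite sE; case: Gt => _ _ _ _; apply.
have ls : linear_over L s.
  by split=> [u v|l u Ll]; rewrite ?rmorphD // rmorphM sL.
apply/eqP; rewrite -(fmorph_eq0 kappa) -(mpoly_form_automorphism (s := s)) ?sE //.
by rewrite -sE Jp.
Qed.

End over_subfield.
End galois.

(** * The correspondence *)

(* A semilinear descent: the space of relations a is stable under H, hence spanned
   by relations with coefficients fixed by H, which sigma preserves. *)
Lemma relations_of_fixing (M : fieldType) (H : set (M -> M)) (s : {rmorphism M -> M})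
    (r : nat) (a mu : 'I_r -> M) :
    (forall t, H t -> exists t' : {rmorphism M -> M}, t' = t :> (M -> M)) ->
    H id -> (forall t t', H t -> H t' -> H (t \o t')) ->
    (forall t, H t -> exists2 t', H t' & cancel t' t) ->
    (forall x, (forall t, H t -> t x = x) -> s x = x) ->
    (forall t, H t -> \sum_k a k * t (mu k) = 0) ->
  \sum_k a k * s (mu k) = 0.
Proof.
move=> Hmor Hid Hcomp Hinv sfix; elim: r a mu => [|r IH] a mu rel; first by rewrite big_ord0.
have drop b j : b j = 0 -> (forall t, H t -> \sum_k b k * t (mu k) = 0) ->
    \sum_k b k * s (mu k) = 0.
  move=> bj relb; rewrite (bigD1_ord j) //= bj mul0r add0r.
  apply: (IH (fun k => b (lift j k)) (fun k => mu (lift j k))) => t /relb.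
  by rewrite (bigD1_ord j) //= bj mul0r add0r.
have [a0|a0] := eqVneq (a ord0) 0; first exact: drop a0 rel.
pose b k := a k / a ord0.
have relb t : H t -> \sum_k b k * t (mu k) = 0.
  move=> /rel e; transitivity ((a ord0)^-1 * \sum_k a k * t (mu k)).
    by rewrite mulr_sumr; apply: eq_bigr => k _; rewrite mulrA [_^-1 * _]mulrC.
  by rewrite e mulr0.
suff sb : \sum_k b k * s (mu k) = 0.
  transitivity (a ord0 * \sum_k b k * s (mu k)); last by rewrite sb mulr0.
  by rewrite mulr_sumr; apply: eq_bigr => k _; rewrite mulrA [_ * b k]mulrC divfK.
have [bfix|] := pselect (forall k t, H t -> t (b k) = b k).
  transitivity (s (\sum_k b k * mu k)); last by rewrite (relb _ Hid) rmorph0.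
  rewrite rmorph_sum; apply: eq_bigr => k _.
  by rewrite rmorphM (sfix (b k)) // => t; exact: bfix.
move=> /existsNP[j /existsNP[t /not_implyP[Ht /eqP bj]]].
(* The sum of t (b k) * t' (mu k) is t applied to the relation b at t^-1 t', so d is again a
   relation; its first coefficient is 0 because that of b is 1. *)
pose d k := t (b k) - b k.
have [t1 t1E] := Hmor _ Ht.
have reld t' : H t' -> \sum_k d k * t' (mu k) = 0.
  move=> Ht'; rewrite (eq_bigr (fun k => t (b k) * t' (mu k) - b k * t' (mu k))).
    rewrite sumrB relb // subr0; have [w Hw wK] := Hinv _ Ht.
    transitivity (t1 (\sum_k b k * (w \o t') (mu k))); last first.
      by rewrite (relb _ (Hcomp _ _ Hw Ht')) rmorph0.
    by rewrite rmorph_sum; apply: eq_bigr => k _; rewrite rmorphM /= t1E wK.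
  by move=> k _; rewrite mulrBl.
have d0 : d ord0 = 0 by rewrite /d /b divff // -t1E rmorph1 subrr.
have sd := drop d ord0 d0 reld.
have dj : d j != 0 by rewrite subr_eq0.
(* Subtracting this multiple of d kills coordinate j of b, so d and the difference both fall under
   the induction hypothesis. *)
have ej : b j - b j / d j * d j = 0 by rewrite divfK // subrr.
have := drop (fun k => b k - b j / d j * d k) j ej.
have split_sum (t' : M -> M) : \sum_k (b k - b j / d j * d k) * t' (mu k) =
    \sum_k b k * t' (mu k) - b j / d j * \sum_k d k * t' (mu k).
  by rewrite mulr_sumr -sumrB; apply: eq_bigr => k _; rewrite mulrBl mulrA.
rewrite split_sum sd mulr0 subr0; apply=> t' Ht'.
by rewrite split_sum relb // reld // mulr0 subrr.
Qed.

Lemma diff_subfieldP (M : diffFieldType) (L : set M) :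
  diff_subfield L <-> subfield L /\ forall x, L x -> L (der x).
Proof.
split=> [[[L1 LB Ld] dL]|[[L1 LB Ld] dL]]; split=> //; split.
- exact: set_mem.
- by move=> x y Lx Ly; apply/set_mem/LB; exact: mem_set.
- by move=> x y Lx Ly; apply/set_mem/Ld; exact: mem_set.
- exact: mem_set.
- by move=> x y /set_mem Lx /set_mem Ly; apply/mem_set/LB.
- by move=> x y /set_mem Lx /set_mem Ly; apply/mem_set/Ld.
Qed.

(** For t = id this handles fixed fields; for two automorphisms it reduces their equality to
    generators. *)
Lemma equalizer_diff_subfield (M : diffFieldType) (L1 L2 : set M) (s t : M -> M) :
  diff_gal L1 s -> diff_gal L2 t -> diff_subfield [set x | s x = t x].
Proof.
move=> Gs Gt; have [[s' sE] [t' tE]] := (diff_gal_rmorphism Gs, diff_gal_rmorphism Gt).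
case: Gs Gt => _ _ _ sd _ [_ _ _ td _]; apply/diff_subfieldP.
rewrite -sE -tE in sd td *; split; last by move=> x /= e; rewrite sd td e.
split=> [|x y /= ex ey|x y /= ex ey]; first by rewrite /= !rmorph1.
  by rewrite !rmorphB ex ey.
by rewrite !fmorph_div ex ey.
Qed.

Lemma diff_gal_id (M : diffFieldType) (L : set M) : diff_gal L id.
Proof. by split=> //; exists id. Qed.

Lemma diff_gal_comp (M : diffFieldType) (L : set M) (s t : M -> M) :
  diff_gal L s -> diff_gal L t -> diff_gal L (s \o t).
Proof.
move=> [sZ sM sb sd sL] [tZ tM tb td tL]; split.
- by move=> x y /=; rewrite tZ sZ.
- by split=> [|x y] /=; [rewrite tM.1 sM.1|rewrite tM.2 sM.2].
- exact: bij_comp.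
- by move=> x /=; rewrite td sd.
- by move=> x Lx /=; rewrite tL // sL.
Qed.

Lemma diff_gal_inv (M : diffFieldType) (L : set M) (s t : M -> M) :
  diff_gal L s -> cancel s t -> cancel t s -> diff_gal L t.
Proof.
move=> [sZ sM sb sd sL] st ts; have sI := can_inj st; split.
- by move=> x y; apply: sI; rewrite sZ !ts.
- by split=> [|x y]; apply: sI; rewrite ts ?sM.1 ?sM.2 ?ts.
- by exists s.
- by move=> x; apply: sI; rewrite sd !ts.
- by move=> x Lx; apply: sI; rewrite ts sL.
Qed.

Section picard_vessiot.
Variables (K M : diffFieldType) (iota : {rmorphism K -> M}).
Variables (n : nat) (a : 'I_n -> K) (u : 'I_n -> M).
Hypothesis iota_der : diff_embedding iota.
Hypothesis PV : picard_vessiot iota a u.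

Definition const_embedding : constField K -> M := iota \o val.
HB.instance Definition _ := GRing.RMorphism.on const_embedding.
Local Notation kappa := const_embedding.

Definition wronskian_matrix : 'M[M]_n := \matrix_(i < n, j < n) iter j der (u i).
Local Notation Y := wronskian_matrix.

(** Right multiplication shifts the columns of Y to the next derivative. The last column encodes the
    equation: the l-th derivative has coefficient a_(n-l), which is [a (rev_ord l)]. *)
Definition companion_matrix : 'M[M]_n :=
  \matrix_(l < n, j < n) if (j.+1 < n)%N then (l == j.+1 :> nat)%:R
                         else - iota (a (rev_ord l)).
Local Notation A := companion_matrix.

Lemma der_kappa c : der (kappa c) = 0.
Proof. by rewrite /const_embedding /= -iota_der (eqP (valP c)) rmorph0. Qed.

Lemma kappa_surj x : der x = 0 -> exists c, x = kappa c.
Proof.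
move=> /eqP; rewrite -[_ == _]/(x \in @Defs.constant M) => x0.
case: PV => _ _ _ /(_ (ConstField x0))[c cE].
by exists c; rewrite /const_embedding /= -[LHS]cE.
Qed.

Lemma wronskian_unit : Y \in unitmx.
Proof. by case: PV => _ w0 _ _; rewrite unitmxE unitfE. Qed.

Lemma der_wronskian : map_mx der Y = Y *m A.
Proof.
apply/matrixP => i j; rewrite !mxE -iterS.
have [jn|jn] := ltnP j.+1 n.
  rewrite (bigD1 (Ordinal jn)) //= !mxE /= jn eqxx mulr1 big1 ?addr0 // => l lj.
  rewrite !mxE jn; case: eqP => [e|_]; last by rewrite mulr0.
  by case/eqP: lj; exact: val_inj.
have -> : j.+1 = n by apply/eqP; rewrite eqn_leq jn ltn_ord.
case: PV => /(_ i) sol _ _ _; move/eqP: sol; rewrite /solves_lde addr_eq0 => /eqP ->.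
rewrite (reindex_inj rev_ord_inj) -sumrN; apply: eq_bigr => l _ /=.
rewrite !mxE ltnNge jn /= -mulNr mulrC; congr (iter _ _ _ * _).
exact: (congr1 val (rev_ordK l)).
Qed.

Lemma iota_subfield : diff_subfield (range iota).
Proof.
apply/diff_subfieldP; split; last by move=> _ [x _ <-]; exists (der x).
split; first by exists 1; rewrite ?rmorph1.
  by move=> _ _ [x _ <-] [y _ <-]; exists (x - y); rewrite ?rmorphB.
by move=> _ _ [x _ <-] [y _ <-]; exists (x / y); rewrite ?fmorph_div.
Qed.

Lemma companion_iota i j : range iota (A i j).
Proof.
rewrite mxE; case: ifP => _; last by exists (- a (rev_ord i)); rewrite ?rmorphN.
by exists (i == j.+1 :> nat)%:R; rewrite ?rmorph_nat.
Qed.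

Lemma generated_ind (L : set M) : diff_subfield L -> range iota `<=` L ->
  (forall i, L (u i)) -> forall x, L x.
Proof.
move=> dL iL uL x; case: PV => _ _ gen _.
have : diff_generated (range iota `|` range u) x by rewrite gen.
by apply: smallest_sub => // y [/iL|[i _ <-]].
Qed.

Section intermediate.
Variable L : set M.
Hypothesis interL : intermediate iota L.

Let Lsub : subfield L.
Proof. by case: interL => /diff_subfieldP[]. Qed.

Lemma intermediate_der x : L x -> L (der x).
Proof. by case: interL => /diff_subfieldP[_ dL] _; exact: dL. Qed.

Lemma intermediate_companion i j : L (A i j).
Proof. by case: interL => _; apply; exact: companion_iota. Qed.

Lemma intermediate_kappa c : L (kappa c).
Proof. by case: interL => _; apply; exists (val c). Qed.

(** The fractions in Y over L contain K and u, and Y' = Y A makes them closed under derivation, so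
    they exhaust M. *)
Lemma rational_functions x : exists F G : {mpoly M[n * n]},
  [/\ mpoly_over L F, mpoly_over L G, G.@[mxvec Y 0] != 0 &
      x = F.@[mxvec Y 0] / G.@[mxvec Y 0]].
Proof.
have L1 : L 1 by case: Lsub.
have LN1 : L (-1) by exact: subfieldN.
have pol F : mpoly_over L F -> exists F' G, [/\ mpoly_over L F', mpoly_over L G,
    G.@[mxvec Y 0] != 0 & F.@[mxvec Y 0] = F'.@[mxvec Y 0] / G.@[mxvec Y 0]].
  move=> LF; exists F, 1; rewrite meval1 divr1; split=> //; first exact: mpoly_over1.
  exact: oner_neq0.
move: x; apply: generated_ind.
- apply/diff_subfieldP; split.
    split=> [|_ _ [F [G [LF LG G0 ->]]] [F' [G' [LF' LG' G'0 ->]]]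
             |_ _ [F [G [LF LG G0 ->]]] [F' [G' [LF' LG' G'0 ->]]]].
    + by rewrite -(meval1 (mxvec Y 0)); apply: pol; exact: mpoly_over1.
    + exists (F * G' - F' * G), (G * G'); split.
      * by apply: mpoly_overB => //; exact: mpoly_overM.
      * exact: mpoly_overM.
      * by rewrite mevalM mulf_neq0.
      * by rewrite mevalB !mevalM; field; rewrite G0 G'0.
    (* Division by zero has value 0, which is again such a fraction. *)
    + have [F'0|F'0] := eqVneq F'.@[mxvec Y 0] 0.
        rewrite F'0 mul0r invr0 mulr0.
        have := pol 0%:MP (mpoly_overC _ (subfield0 Lsub)).
        by rewrite [in X in X -> _]mevalC.
      exists (F * G'), (G * F'); split; [exact: mpoly_overM|exact: mpoly_overM| |].
        by rewrite mevalM mulf_neq0.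
      by rewrite !mevalM; field; rewrite G0 F'0 G'0.
  move=> _ [F [G [LF LG G0 ->]]].
  have dE := mpoly_over_der Lsub intermediate_der intermediate_companion.
  have [[F' LF' F'E] [G' LG' G'E]] := (dE _ LF, dE _ LG).
  exists (F' * G - F * G'), (G * G); split.
  + by apply: mpoly_overB => //; exact: mpoly_overM.
  + exact: mpoly_overM.
  + by rewrite mevalM mulf_neq0.
  + have dY := der_wronskian.
    rewrite derM derV // F'E // G'E // mevalB !mevalM; field; exact: G0.
- move=> _ [x _ <-]; rewrite -(mevalC (mxvec Y 0) (iota x)); apply: pol.
  by apply: mpoly_overC; case: interL => _; apply; exists x.
- move=> i; have n0 : (0 < n)%N by exact: leq_ltn_trans (ltn_ord i).
  rewrite (_ : u i = ('X_(mxvec_index i (Ordinal n0))).@[mxvec Y 0]).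
    by apply: pol; exact: mpoly_overX.
  by rewrite mevalXU mxvecE mxE.
Qed.

End intermediate.

(** u is the first column of Y; as c is constant, differentiating the relation on u gives the other
    columns. *)
Lemma gal_matrixP (L : set M) (sigma : M -> M) (c : 'M[constField K]_n) :
    diff_gal L sigma ->
  (forall i, sigma (u i) = \sum_(j < n) iota (cval (c i j)) * u j) <->
  map_mx sigma Y = translate kappa c Y.
Proof.
move=> [_ _ _ sd _].
have iter_sd k x : sigma (iter k der x) = iter k der (sigma x).
  by elim: k => //= k <-; rewrite sd.
split=> [su|sY i]; last first.
  have n0 : (0 < n)%N by exact: leq_ltn_trans (ltn_ord i).
  have := congr1 (fun b : 'M_n => b i (Ordinal n0)) sY; rewrite !mxE /= => ->.
  by apply: eq_bigr => j _; rewrite !mxE.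
apply/matrixP => i k; rewrite !mxE iter_sd su.
transitivity (\sum_(j < n) kappa (c i j) * iter k der (u j)).
  elim: (k : nat) => //= m ->; rewrite der_sum; apply: eq_bigr => j _.
  by rewrite derM der_kappa mul0r add0r.
by apply: eq_bigr => j _; rewrite !mxE.
Qed.

Lemma iota_intermediate : intermediate iota (range iota).
Proof. by split=> //; exact: iota_subfield. Qed.

Lemma gal_matrix (L : set M) (sigma : M -> M) : intermediate iota L ->
    diff_gal L sigma ->
  exists2 c, c \in unitmx & map_mx sigma Y = translate kappa c Y.
Proof.
move=> iL Gs; have [s sE] := diff_gal_rmorphism Gs.
have [_ _ _ sd sL] := Gs; rewrite -sE in sd sL *.
apply: (automorphism_matrix (kappa := kappa) kappa_surj wronskian_unit der_wronskian sd).
by move=> i j; apply: sL; exact: intermediate_companion.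
Qed.

Lemma translate_inj (c d : 'M[constField K]_n) :
  translate kappa c Y = translate kappa d Y -> c = d.
Proof.
move=> /(congr1 (mulmx^~ (invmx Y))); rewrite /translate !mulmxK ?wronskian_unit //.
by move=> e; apply/matrixP => i j; apply: (fmorph_inj kappa);
  have := congr1 (fun b : 'M_n => b i j) e; rewrite !mxE.
Qed.

Hypothesis char0 : [pchar K] =i pred0.
Hypothesis closedC : GRing.closed_field_axiom (constField K).

Lemma pchar_extension : [pchar M] =i pred0.
Proof. by move=> p; rewrite (fmorph_pchar iota) char0. Qed.

Lemma fixed_field_intermediate L : intermediate iota L ->
  L = [set x | forall sigma, diff_gal L sigma -> sigma x = x].
Proof.
move=> iL; apply/seteqP; split=> [x Lx s [_ _ _ _]|x fixx]; first by apply.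
have [/diff_subfieldP[Lsub _] _] := iL.
exact: (fixed_field (kappa := kappa) der_kappa kappa_surj wronskian_unit der_wronskian
  Lsub (intermediate_der iL) (intermediate_companion iL) (intermediate_kappa iL)
  (rational_functions iL) closedC pchar_extension fixx).
Qed.

(** The defining polynomials are all those that vanish on the matrices of Gal(M/L);
    [zariski_closure_gal] shows that they cut out no further invertible matrix. *)
Lemma gal_algebraic L : intermediate iota L ->
  algebraic_subgroup iota u (diff_gal L).
Proof.
move=> iL; have [/diff_subfieldP[Lsub _] iotaL] := iL; split.
  split.
  - by move=> s [sZ sM sb sd sL]; split=> // x /iotaL; exact: sL.
  - exact: diff_gal_id.
  - by move=> s t; exact: diff_gal_comp.
  - by move=> s t; exact: diff_gal_inv.
exists [set p | forall tau d, diff_gal L tau -> map_mx tau Y = translate kappa d Y ->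
  p.@[mxvec d 0] = 0].
apply/seteqP; split=> [c [s Gs /(gal_matrixP _ Gs) sc]|c [cu cS]].
  split; last by move=> p Sp; exact: Sp Gs sc.
  have [d du sd] := gal_matrix iL Gs.
  by rewrite (translate_inj (etrans (esym sc) sd)).
have [s Gs /(gal_matrixP _ Gs) sc] := zariski_closure_gal (kappa := kappa) der_kappa
  kappa_surj wronskian_unit der_wronskian Lsub (intermediate_der iL)
  (intermediate_companion iL) (intermediate_kappa iL) (rational_functions iL) cu cS.
by exists s.
Qed.

Lemma gal_fixed_field (H : set (M -> M)) : algebraic_subgroup iota u H ->
    let L := [set x | forall t, H t -> t x = x] in
  intermediate iota L /\ diff_gal L = H.
Proof.
move=> [[HG Hid Hcomp Hinv] [S HS]] L.
have iL : intermediate iota L.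
  split; last by move=> x ix t /HG[_ _ _ _]; apply.
  have fixed t : H t -> subfield [set x | t x = x] /\
      (forall x, t x = x -> t (der x) = der x).
    move=> /HG Gt; apply/diff_subfieldP.
    exact: equalizer_diff_subfield Gt (diff_gal_id (range iota)).
  apply/diff_subfieldP; split; last by move=> x Lx t Ht; apply: (fixed t Ht).2; exact: Lx.
  split=> [t /fixed[[]]//|x y Lx Ly t Ht|x y Lx Ly t Ht].
    by case: (fixed t Ht) => -[_ + _] _; apply; [exact: Lx|exact: Ly].
  by case: (fixed t Ht) => -[_ _ +] _; apply; [exact: Lx|exact: Ly].
split=> //; apply/seteqP; split=> [s Gs|t Ht]; last first.
  by have [tZ tM tb td _] := HG t Ht; split=> // x; apply.
have [s' sE] := diff_gal_rmorphism Gs.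
have [c cu sc] := gal_matrix iL Gs.
have : gal_matrices iota u H c.
  rewrite HS; split=> // p Sp.
  (* For an automorphism t, p at the matrix of t is the sum of the coefficients of F times t of the
     monomials in Y. This is where the relation with a_k and mu_k comes from. *)
  pose F := psi kappa Y p; pose w k := nth 0%MM (msupp F) k.
  have formE t : mpoly_form (mxvec Y 0) t 1 F =
      \sum_(k < size (msupp F)) F@_(w k) * t (('X_[w k]).@[mxvec Y 0] * 1).
    by rewrite /mpoly_form (big_nth 0%MM) big_mkord.
  apply/eqP; rewrite -(fmorph_eq0 kappa).
  rewrite -(mpoly_form_automorphism wronskian_unit (s := s')) ?sE // -sE formE.
  apply/eqP; apply: (@relations_of_fixing _ H) => //.
  - by move=> t /HG; exact: diff_gal_rmorphism.
  - move=> t Ht; have [_ _ [t' tt' t't] _ _] := HG t Ht; exists t' => //.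
    exact: Hinv tt' t't.
  - by move=> x Lx; rewrite sE; case: Gs => _ _ _ _; apply.
  move=> t Ht; rewrite -formE; have Gt := HG t Ht.
  have [t' tE] := diff_gal_rmorphism Gt.
  have [d du td] := gal_matrix iota_intermediate Gt.
  rewrite -tE (mpoly_form_automorphism wronskian_unit (c := d)) ?tE //.
  have : gal_matrices iota u H d by exists t => //; apply/(gal_matrixP _ Gt).
  by rewrite HS => -[_ /(_ p Sp) ->]; rewrite rmorph0.
(* t and s have the same matrix, so they agree on u and on K, hence everywhere. *)
move=> [t Ht tc]; suff -> : s = t by [].
have Gt := HG t Ht; apply/funext; apply: generated_ind.
- exact: equalizer_diff_subfield Gs Gt.
- move=> x ix /=; have [_ _ _ _ ->] := Gt => //.
  by have [_ _ _ _] := Gs; apply; case: iL => _; apply.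
- by move=> i; rewrite /= tc; apply: (gal_matrixP c Gs).2.
Qed.

End picard_vessiot.

Theorem mainTheorem4 (K M : diffFieldType) (iota : {rmorphism K -> M})
    (n : nat) (a : 'I_n -> K) (u : 'I_n -> M)
    (char0 : [pchar K] =i pred0)
    (closedC : GRing.closed_field_axiom (constField K))
    (iota_der : diff_embedding iota)
    (PV : picard_vessiot iota a u) :
  set_bij (intermediate iota) (algebraic_subgroup iota u) (@diff_gal M).
Proof.
split.
- by move=> L iL; exact: (gal_algebraic iota_der PV iL).
- move=> L1 L2 /set_mem iL1 /set_mem iL2 e.
  rewrite (fixed_field_intermediate iota_der PV char0 closedC iL1).
  by rewrite (fixed_field_intermediate iota_der PV char0 closedC iL2) e.
- move=> H /(gal_fixed_field iota_der PV)[iL e].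
  by exists [set x | forall t, H t -> t x = x].
Qed.
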